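(* Let $n\ge 2$ and let $\hat\Gamma$ be a homogeneous differential equation field on $T^n_\circ M$, so that the distribution $\mathfrak{D}^+$ spanned by $\hat\Gamma,\Delta^1,\dots,\Delta^n$ is involutive. Then there is a smooth function $\mu$ on $T^n_\circ M$ such that the differential equation field $\Gamma=\hat\Gamma+\mu\Delta^n\in\mathfrak{D}^+$ satisfies $$[\Delta^1,\Gamma]=\Gamma,\qquad [\Delta^2,\Gamma]=2\Delta^1 .$$
   Context: Manifolds are $C^\infty$, Hausdorff, second-countable and connected. $M$ is a manifold of dimension $m$ with local coordinates $(y^i)$. $T^nM$ is the manifold of $n$-jets at zero $j^n_0\gamma$ of curves $\gamma:(a,b)\to M$ with $0\in(a,b)$, with local coordinates $y^i_r(j^n_0\gamma)=\frac{d^r\gamma^i}{dx^r}(0)$, $0\le r\le n$ ($y^i_0=y^i$). $T^n_\circ M\subset T^nM$ is the open submanifold of jets with $\gamma'(0)\ne0$. Repeated index $i$ is summed. The vector fields $\Delta^1,\dots,\Delta^n$ on $T^n_\circ M$ are given in coordinates by $\Delta^r=\sum_{s=r}^n\frac{s!}{(s-r)!}\,y^i_{s+1-r}\frac{\partial}{\partial y^i_s}$; they are globally defined (they are the fundamental vector fields of the right action, by reparametrization, on $T^n_\circ M$ of the group of $n$-jets at $0$ of local diffeomorphisms of $\mathbb{R}$ fixing $0$). A differential equation field on $T^n_\circ M$ is a vector field of the coordinate form $\Gamma=\sum_{r=0}^{n-1}y^i_{r+1}\frac{\partial}{\partial y^i_r}+\Gamma^i\frac{\partial}{\partial y^i_n}$,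 where the $\Gamma^i$ are smooth functions of $(y^j_0,\dots,y^j_n)$. It is homogeneous if the distribution $\mathfrak{D}^+$ spanned by $\Gamma,\Delta^1,\dots,\Delta^n$ is involutive. *)

(* Defs.v *)
From HB Require Import structures.
From mathcomp Require Import all_boot all_order all_algebra.
From mathcomp Require Import all_classical all_reals all_analysis.

Set Implicit Arguments.
Unset Strict Implicit.
Unset Printing Implicit Defensive.

Import Order.TTheory GRing.Theory Num.Theory.
Import numFieldNormedType.Exports.
Local Open Scope classical_set_scope.
Local Open Scope ring_scope.

(** ** Smooth maps between normed spaces *)

Definition iter_derive (R : realType) (V W : normedModType R)
    (vs : seq V) (f : V -> W) : V -> W :=
  foldr (fun v (g : V -> W) => (fun x => 'D_v g x) : V -> W) f vs.

(** Meant for [U] open: all iterated directional derivatives of [f] exist and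
    are differentiable on [U]. *)
Definition smooth_on (R : realType) (V W : normedModType R)
    (U : set V) (f : V -> W) : Prop :=
  forall (vs : seq V) (x : V), U x -> differentiable (iter_derive vs f) x.

(** ** Manifolds *)

(** [chart_map] and [chart_inv] are total; only their values on [chart_dom] and
    on the image [chart_map @` chart_dom] are meaningful. *)
Record chart (R : realType) (m : nat) (M : topologicalType) := Chart {
  chart_dom : set M;
  chart_map : M -> 'rV[R]_m;
  chart_inv : 'rV[R]_m -> M;
  chart_dom_open : open chart_dom;
  chart_im_open : open (chart_map @` chart_dom);
  chart_mapK : forall p, chart_dom p -> chart_inv (chart_map p) = p;
  chart_map_cts : forall p, chart_dom p -> {for p, continuous chart_map};
  chart_inv_cts :
    forall y, (chart_map @` chart_dom) y -> {for y, continuous chart_inv} }.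

(** The atlas need not be maximal: it determines the smooth structure. *)
Record manifold (R : realType) (m : nat) := Manifold {
  carrier :> topologicalType;
  atlas : set (chart R m carrier);
  manifold_hausdorff : hausdorff_space carrier;
  manifold_second_countable : @second_countable carrier;
  manifold_connected : connected [set: carrier];
  atlas_cover : forall p : carrier, exists2 c, atlas c & chart_dom c p;
  atlas_compatible : forall c d, atlas c -> atlas d ->
    smooth_on (chart_map c @` (chart_dom c `&` chart_dom d))
              (chart_map d \o chart_inv c) }.

Section Jets.
Context (R : realType) (m : nat) (M : manifold R m).

(** ** Jets of curves *)

(** A curve defined near [0] is a total function whose values outside some open
    interval around [0] are irrelevant. *)
Definition smooth_curve (gam : R -> M) : Prop :=
  exists a b : R, [/\ a < 0, 0 < b,
    forall t, a < t < b -> {for t, continuous gam} &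
    forall c, atlas c ->
      smooth_on [set t : R | a < t < b /\ chart_dom c (gam t)]
                (chart_map c \o gam)].

Definition curve_derive (c : chart R m M) (gam : R -> M) (r : nat) : 'rV[R]_m :=
  derive1n r (chart_map c \o gam) 0.

Definition regular_curve (gam : R -> M) : Prop :=
  forall c, atlas c -> chart_dom c (gam 0) -> curve_derive c gam 1 != 0.

Definition same_jet (n : nat) (gam del : R -> M) : Prop :=
  gam 0 = del 0 /\
  forall c, atlas c -> chart_dom c (gam 0) ->
    forall r, (r <= n)%N -> curve_derive c gam r = curve_derive c del r.

Definition jet (n : nat) (gam : R -> M) : set (R -> M) :=
  [set del | smooth_curve del /\ same_jet n gam del].

(** The manifold of regular [n]-jets at [0], a point being an equivalence class
    of curves. *)
Record regular_jet (n : nat) := RegularJet {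
  jet_class : set (R -> M);
  jet_classP : exists gam,
    [/\ smooth_curve gam, regular_curve gam & jet_class = jet n gam] }.

Context (n : nat).
Notation TnM := (regular_jet n).
Notation coords := 'M[R]_(n.+1, m).

Definition jet_rep (j : TnM) : R -> M := sval (cid (jet_classP j)).

(** Row [r] of [jet_coord c j] is [(y^i_r(j))_i]. *)
Definition jet_coord (c : chart R m M) (j : TnM) : coords :=
  \matrix_(r, i) (curve_derive c (jet_rep j) r) 0 i.

Definition jet_over (c : chart R m M) : set TnM :=
  [set j | chart_dom c (jet_rep j 0)].

(** [f] read in the chart of jets induced by [c]; the value is [0] off the
    image of that chart. *)
Definition in_coords (c : chart R m M) (f : TnM -> R) (Y : coords) : R :=
  xget 0 [set a | exists j, [/\ jet_over c j, jet_coord c j = Y & f j = a]].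

Definition smooth_fun (f : TnM -> R) : Prop :=
  forall c, atlas c -> smooth_on (jet_coord c @` jet_over c) (in_coords c f).

(** ** Vector fields, as derivations of the ring of smooth functions *)

(** Operators are defined on all functions, but only their action on smooth
    functions is meaningful. *)
Definition operator : Type := (TnM -> R) -> TnM -> R.

Definition vector_field (X : operator) : Prop :=
  [/\ forall f, smooth_fun f -> smooth_fun (X f),
      forall (a : R) f g, smooth_fun f -> smooth_fun g ->
        forall j, X (fun k => a * f k + g k) j = a * X f j + X g j &
      forall f g, smooth_fun f -> smooth_fun g ->
        forall j, X (fun k => f k * g k) j = X f j * g j + f j * X g j].

Definition lie_bracket (X Y : operator) : operator :=
  fun f j => X (Y f) j - Y (X f) j.

Definition same_field (X Y : operator) : Prop :=
  forall f, smooth_fun f -> forall j, X f j = Y f j.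

(** [X] is [V^i_r d/dy^i_r] on the jets over [c]: the directional derivative
    along [V Y] is the derivation with components [V Y]. *)
Definition has_components (X : operator) (c : chart R m M)
    (V : coords -> coords) : Prop :=
  forall f, smooth_fun f -> forall j, jet_over c j ->
    X f j = 'D_(V (jet_coord c j)) (in_coords c f) (jet_coord c j).

(** For [0 < r], the index [s + 1 - r] is at most [s], so [inord] is exact. *)
Definition Delta_comp (r : nat) (Y : coords) : coords :=
  \matrix_(s, i)
    if (r <= s)%N then (s`!)%:R / ((s - r)`!)%:R * Y (inord (s + 1 - r)) i
    else 0.

Definition chart_at (j : TnM) : chart R m M :=
  s2val (cid2 (atlas_cover (jet_rep j 0))).

(** The value at [j] is computed in a chosen chart around [j]; as the Delta^r
    are globally defined, it is the same in every chart of the atlas. *)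
Definition Delta (r : nat) : operator := fun f j =>
  'D_(Delta_comp r (jet_coord (chart_at j) j))
    (in_coords (chart_at j) f) (jet_coord (chart_at j) j).

Definition de_field (Gam : operator) : Prop :=
  vector_field Gam /\
  forall c, atlas c -> exists2 G : coords -> 'rV[R]_m,
    smooth_on (jet_coord c @` jet_over c) G &
    has_components Gam c (fun Y => \matrix_(r, i)
      if (r < n)%N then Y (inord r.+1) i else G Y 0 i).

(** ** Distributions *)

(** A distribution assigns to each point a set of tangent vectors, here seen as
    functionals on smooth functions. *)
Definition distribution : Type := TnM -> set ((TnM -> R) -> R).

Definition in_distribution (D : distribution) (X : operator) : Prop :=
  vector_field X /\ forall j, D j (fun f => X f j).

Definition involutive_distribution (D : distribution) : Prop :=
  forall X Y, in_distribution D X -> in_distribution D Y ->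
    in_distribution D (lie_bracket X Y).

(** The span of [Gam, Delta^1, ..., Delta^n]. *)
Definition Dplus (Gam : operator) : distribution := fun j =>
  [set v | exists (a : R) (b : 'I_n -> R), forall f, smooth_fun f ->
     v f = a * Gam f j + \sum_(r < n) b r * Delta r.+1 f j].

Definition homogeneous (Gam : operator) : Prop :=
  involutive_distribution (Dplus Gam).

End Jets.

(* Main.v *)
Require Import Defs.
From HB Require Import structures.
From mathcomp Require Import all_boot all_order all_algebra.
From mathcomp Require Import all_classical all_reals all_analysis.
From mathcomp Require Import ring.
Set Implicit Arguments.
Unset Strict Implicit.
Unset Printing Implicit Defensive.
Import Order.TTheory GRing.Theory Num.Theory.
Import numFieldNormedType.Exports.
Local Open Scope classical_set_scope.
Local Open Scope ring_scope.

(** The bracket of [Delta^r] with a differential equation field is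
    [r Delta^(r-1)] (with the field itself for [Delta^0]) up to a vertical
    vector, that is, a combination of the d/dy^i_n: this is a computation with
    the components below the top order ([total_Delta], [bracket_Delta1],
    [bracket_Delta2]). When the field is homogeneous the bracket lies in the
    span of [Ghat, Delta^1, ..., Delta^n], and since the velocity [y_1] does not
    vanish, the vertical vectors of this span are the multiples of [Delta^n]
    ([vertical_span]). Hence there are functions [l1] and [l2] with
    [[Delta^1, Ghat] = Ghat + l1 Delta^n] and
    [[Delta^2, Ghat] = 2 Delta^1 + l2 Delta^n].

    Since [[Delta^1, Delta^n] = (1 - n) Delta^n] and [[Delta^2, Delta^n] = 0],
    the field [Ghat + mu Delta^n] has the required brackets if and only if
    [Delta^1 mu = n mu - l1] and [Delta^2 mu = - l2].

    In one chart these equations have an explicit solution. With the Euclidean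
    inner product of the chart there is a universal function [straight] of the
    jet that satisfies the equations which the product of [y_1] with the last
    component of a correct field has to satisfy; prescribing this product to
    be [straight] determines [mu] ([normalizer]), and differentiating the
    prescription gives the two equations.

    The equations are affine in [mu], and functions of the base point are
    killed by every [Delta^r]. So the solutions in charts can be glued with
    cut-off functions on [M] ([partial_solution_join], [global_solution]); the
    cut-off functions exist because [M] is Hausdorff, and countably many of
    them are enough because [M] is second countable.

    These arguments need the smooth structure of the jets. The [s]-th derivative
    of a curve in a new chart is obtained from the change of chart by applying
    [s] times the total derivative ([prol]). This shows that changes of
    coordinates on jets are smooth and that the [Delta^r] do not depend on the
    chart ([prol_Delta]), and it uses the symmetry of second derivatives
    ([derive_sym]), on which the coordinate formula for Lie brackets
    ([lie_bracket_components]) rests as well. *)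

(** * Smooth functions between normed spaces *)

Section Smooth.
Context {R : realType}.
Implicit Types V W : normedModType R.

Lemma near_eq_differentiable V W (f g : V -> W) x :
  (\near x, f x = g x) -> differentiable f x -> differentiable g x.
Proof.
move=> fg df; have fgx := nbhs_singleton fg.
have cf := diff_continuous df.
have E : g \o shift x = cst (g x) + 'd f x +o_0 id.
  apply/eqaddoP => e e0.
  have /eqaddoP/(_ e e0) := diff_locally df.
  move: fg; rewrite (near_shift 0 x) => fg.
  apply: filter_app; near=> h.
  rewrite /= !fctE -fgx /=.
  suff -> : f (h + x) = g (h + x) by [].
  by near: h; move: fg; apply: filterS => h /=; rewrite subr0.
apply/diff_locallyP; rewrite (diff_unique cf E); split => //.
Unshelve. all: by end_near. Qed.

Lemma open_near_eq V (T : Type) (U : set V) (f g : V -> T) x :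
  open U -> U x -> (forall y, U y -> f y = g y) -> \near x, f x = g x.
Proof.
by move=> oU Ux fg; near=> y; apply: fg; near: y; exact: open_nbhs_nbhs.
Unshelve. all: by end_near. Qed.

Lemma iter_derive_eq V W (U : set V) (f g : V -> W) vs : open U ->
  (forall y, U y -> f y = g y) ->
  forall y, U y -> iter_derive vs f y = iter_derive vs g y.
Proof.
move=> oU fg; elim: vs => [|v vs IH] y Uy /=; first exact: fg.
by apply: near_eq_derive; exact: open_near_eq oU Uy IH.
Qed.

Lemma smooth_on_eq V W (U : set V) (f g : V -> W) : open U ->
  (forall y, U y -> f y = g y) -> smooth_on U f -> smooth_on U g.
Proof.
move=> oU fg sf vs x Ux; apply: near_eq_differentiable (sf vs x Ux).
exact: (open_near_eq oU Ux (iter_derive_eq vs oU fg)).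
Qed.

Lemma smooth_on_sub V W (U O : set V) (f : V -> W) :
  O `<=` U -> smooth_on U f -> smooth_on O f.
Proof. by move=> OU sf vs x /OU; exact: sf. Qed.

Lemma smooth_on_diff V W (U : set V) (f : V -> W) x :
  smooth_on U f -> U x -> differentiable f x.
Proof. by move=> sf Ux; exact: (sf [::]). Qed.

Lemma smooth_on_derive V W (U : set V) (f : V -> W) v :
  smooth_on U f -> smooth_on U ('D_v f).
Proof.
by move=> sf vs x Ux; have := sf (rcons vs v) x Ux; rewrite /iter_derive foldr_rcons.
Qed.

(** Peeling the innermost derivative off an iterated one makes smoothness
    coinductive: to prove a whole class of functions smooth it is enough that
    the class is stable under directional derivatives. *)
Lemma smooth_on_coind V W (U : set V) (P : (V -> W) -> Prop) :
  (forall f, P f -> (forall x, U x -> differentiable f x) /\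
                    forall v, P ('D_v f)) ->
  forall f, P f -> smooth_on U f.
Proof.
move=> HP f Pf vs; elim/last_ind: vs f Pf => [|vs v IH] f Pf x Ux.
  exact: (HP f Pf).1.
by rewrite /iter_derive foldr_rcons; apply: IH => //; exact: (HP f Pf).2.
Qed.

Lemma smooth_on_intro V W (U : set V) (f : V -> W) :
  (forall x, U x -> differentiable f x) -> (forall v, smooth_on U ('D_v f)) ->
  smooth_on U f.
Proof.
move=> df sf vs; elim/last_ind: vs => [|vs v _] x Ux; first exact: df.
by rewrite /iter_derive foldr_rcons; exact: sf.
Qed.

Lemma smooth_on_cst V W (U : set V) (w : W) : smooth_on U (cst w).
Proof.
apply: (@smooth_on_coind _ _ _ (fun f => exists w : W, f = cst w)); last by exists w.
move=> _ [{}w ->]; split=> [x _|v]; first exact: differentiable_cst.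
by exists 0; apply/funext => x; rewrite derive_cst.
Qed.

Lemma deriveDdir V W (f : V -> W) x v w : differentiable f x ->
  'D_(v + w) f x = 'D_v f x + 'D_w f x.
Proof. by move=> df; rewrite !deriveE// linearD. Qed.

Lemma deriveZdir V W (f : V -> W) x v a : differentiable f x ->
  'D_(a *: v) f x = a *: 'D_v f x.
Proof. by move=> df; rewrite !deriveE// linearZ. Qed.

Lemma deriveNdir V W (f : V -> W) x v : differentiable f x ->
  'D_(- v) f x = - 'D_v f x.
Proof. by move=> df; rewrite !deriveE// linearN. Qed.

Lemma derive_basis W p q (f : 'M[R]_(p, q) -> W) Y A : differentiable f Y ->
  'D_A f Y = \sum_i \sum_j A i j *: 'D_(delta_mx i j) f Y.
Proof.
move=> df; rewrite deriveE// {1}(matrix_sum_delta A) linear_sum.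
apply: eq_bigr => i _; rewrite linear_sum; apply: eq_bigr => j _.
by rewrite linearZ deriveE.
Qed.

Lemma differentiable_sumf V W (I : finType) (F : I -> V -> W) x :
  (forall i, differentiable (F i) x) -> differentiable (fun y => \sum_i F i y) x.
Proof.
move=> dF; elim: (index_enum I) => [|i s IH].
  by under eq_fun do rewrite big_nil; exact: differentiable_cst.
by under eq_fun do rewrite big_cons; exact: differentiableD.
Qed.

Lemma differentiable_mxP V p q (f : V -> 'M[R]_(p, q)) x :
  differentiable f x <-> forall i j, differentiable (fun y => f y i j) x.
Proof.
split=> [df i j|df].
  exact: (@differentiable_comp _ _ _ _ f (fun N : 'M[R]_(p, q) => N i j : R) x df
    (differentiable_coord _ _ _)).
have -> : f = fun y => \sum_i \sum_j f y i j *: delta_mx i j.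
  by apply/funext => y; exact: matrix_sum_delta.
apply: differentiable_sumf => i; apply: differentiable_sumf => j.
exact: differentiableZl.
Qed.

Lemma derive_coord V p q (f : V -> 'M[R]_(p, q)) x v i j : differentiable f x ->
  'D_v (fun y => f y i j) x = ('D_v f x) i j.
Proof. by move=> df; rewrite derive_mx ?mxE//; exact: diff_derivable. Qed.

Lemma derive_comp V W (Z : normedModType R) (f : W -> Z) (g : V -> W) x v :
  differentiable g x -> differentiable f (g x) ->
  'D_v (fun y => f (g y)) x = 'D_('D_v g x) f (g x).
Proof.
move=> dg df; rewrite [LHS](@deriveE _ _ _ (f \o g)); last exact: differentiable_comp.
by rewrite diff_comp//= [RHS]deriveE//; congr ('d _ _ _); rewrite deriveE.
Qed.

(** The Leibniz, quotient and chain rules express a derivative with the same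
    operations as the function, so the terms built from smooth functions are
    stable under derivation, and one coinduction proves all the closure
    properties of smoothness. In a composition the chain rule is expanded in
    the coordinates of the intermediate space, which is why that space is a
    space of matrices or the line. *)
Inductive smooth_term V (U : set V) : (V -> R) -> Prop :=
 | term_smooth f : smooth_on U f -> smooth_term U f
 | term_add f g : smooth_term U f -> smooth_term U g ->
     smooth_term U (fun x => f x + g x)
 | term_mul f g : smooth_term U f -> smooth_term U g ->
     smooth_term U (fun x => f x * g x)
 | term_inv f : smooth_term U f -> (forall x, U x -> f x != 0) ->
     smooth_term U (fun x => (f x)^-1)
 | term_comp p q (O : set 'M[R]_(p, q)) (f : 'M[R]_(p, q) -> R) (g : V -> 'M[R]_(p, q)) :
     smooth_on O f -> (forall x, U x -> O (g x)) ->
     (forall i j, smooth_term U (fun x => g x i j)) ->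
     smooth_term U (fun x => f (g x))
 | term_comp1 (O : set R) (f : R -> R) (g : V -> R) :
     smooth_on O f -> (forall x, U x -> O (g x)) -> smooth_term U g ->
     smooth_term U (fun x => f (g x))
 | term_eq f g : (forall x, U x -> f x = g x) -> smooth_term U f ->
     smooth_term U g.

Lemma term_cst V (U : set V) (a : R) : smooth_term U (fun=> a).
Proof. by apply: term_smooth; exact: smooth_on_cst. Qed.

Lemma term_sum V (U : set V) (I : finType) (F : I -> V -> R) :
  (forall i, smooth_term U (F i)) -> smooth_term U (fun x => \sum_i F i x).
Proof.
move=> sF; elim: (index_enum I) => [|i s IH].
  by apply: term_eq (term_cst _ 0) => x _; rewrite big_nil.
by apply: (term_eq _ (term_add (sF i) IH)) => x _; rewrite big_cons.
Qed.

Lemma smooth_term_step V (U : set V) (f : V -> R) : open U -> smooth_term U f ->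
  (forall x, U x -> differentiable f x) /\ forall v, smooth_term U ('D_v f).
Proof.
move=> oU; elim=> {f}.
- move=> f sf; split=> [x Ux|v]; first exact: smooth_on_diff Ux.
  exact/term_smooth/smooth_on_derive.
- move=> f g sf [df Df] sg [dg Dg]; split=> [x Ux|v].
    by apply: (@differentiableD _ _ _ f g); [exact: df|exact: dg].
  apply: (term_eq _ (term_add (Df v) (Dg v))) => x Ux.
  rewrite -(@deriveD _ _ _ f g)//; apply: diff_derivable; [exact: df|exact: dg].
- move=> f g sf [df Df] sg [dg Dg]; split=> [x Ux|v].
    by apply: (@differentiableM _ _ f g); [exact: df|exact: dg].
  apply: (term_eq _ (term_add (term_mul sf (Dg v)) (term_mul sg (Df v)))) => x Ux.
  by rewrite (@deriveM _ _ f g)//; apply: diff_derivable; [exact: df|exact: dg].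
- move=> f sf [df Df] f0; split=> [x Ux|v].
    by apply: (@differentiableV _ _ f); [exact: df|exact: f0].
  have sV := term_inv sf f0.
  apply: (term_eq _ (term_mul (term_cst U (-1)) (term_mul (term_mul sV sV) (Df v)))).
  move=> x Ux; rewrite (@deriveV _ _ f)//; [|exact: f0|apply: diff_derivable; exact: df].
  by rewrite /GRing.scale /= expr2 invfM mulN1r mulNr.
- move=> p q O f g sf gO sg IH.
  have dg x : U x -> differentiable g x.
    by move=> Ux; apply/differentiable_mxP => i j; exact: (IH i j).1.
  have df x : U x -> differentiable f (g x).
    by move=> Ux; apply: smooth_on_diff sf _; exact: gO.
  split=> [x Ux|v].
    by apply: (@differentiable_comp _ _ _ _ g f x); [exact: dg|exact: df].
  apply: (@term_eq _ _ (fun x => \sum_i \sum_j 'D_v (fun y => g y i j) x *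
      'D_(delta_mx i j) f (g x))).
    move=> x Ux; rewrite derive_comp//; [|exact: dg|exact: df].
    rewrite derive_basis; last exact: df.
    apply: eq_bigr => i _; apply: eq_bigr => j _.
    by rewrite derive_coord//; exact: dg.
  apply: term_sum => i; apply: term_sum => j; apply: term_mul.
    exact: (IH i j).2.
  by apply: (@term_comp _ _ _ _ O ('D_(delta_mx i j) f) g) => //; exact: smooth_on_derive.
- move=> O f g sf gO sg [dg Dg].
  have df x : U x -> differentiable f (g x).
    by move=> Ux; apply: smooth_on_diff sf _; exact: gO.
  split=> [x Ux|v].
    by apply: (@differentiable_comp _ _ _ _ g f x); [exact: dg|exact: df].
  apply: (@term_eq _ _ (fun x => 'D_v g x * 'D_1 f (g x))).
    move=> x Ux; rewrite (@derive_comp _ _ _ f g); [|exact: dg|exact: df].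
    rewrite -[in RHS](mulr1 ('D_v g x)) -[X in _ = 'D_X f _]/('D_v g x *: (1 : R)).
    by rewrite deriveZdir//; exact: df.
  apply: term_mul => //.
  by apply: (@term_comp1 _ _ O ('D_1 f) g) => //; exact: smooth_on_derive.
- move=> f g fg sf [df Df]; split=> [x Ux|v].
    by apply: near_eq_differentiable (df x Ux); exact: open_near_eq fg.
  apply: (term_eq _ (Df v)) => x Ux.
  by apply: near_eq_derive; exact: open_near_eq fg.
Qed.

Lemma smooth_termP V (U : set V) (f : V -> R) : open U ->
  smooth_term U f -> smooth_on U f.
Proof.
move=> oU; apply: (@smooth_on_coind _ _ U (smooth_term U)) => {}f.
exact: smooth_term_step.
Qed.

Lemma smooth_on_coord V p q (U : set V) (f : V -> 'M[R]_(p, q)) i j : open U ->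
  smooth_on U f -> smooth_on U (fun x => f x i j).
Proof.
move=> oU sf.
apply: (@smooth_on_coind _ _ U (fun h => exists2 g : V -> 'M[R]_(p, q), smooth_on U g &
  forall x, U x -> g x i j = h x)); last by exists f.
move=> h [g sg gh].
have dg x : U x -> differentiable (fun y => g y i j) x.
  by move=> Ux; move: i j {gh}; apply/differentiable_mxP; exact: smooth_on_diff Ux.
split=> [x Ux|v].
  by apply: near_eq_differentiable (dg x Ux); exact: open_near_eq gh.
exists ('D_v g); first exact: smooth_on_derive.
move=> x Ux; rewrite -derive_coord; last exact: smooth_on_diff Ux.
by apply: near_eq_derive; exact: open_near_eq gh.
Qed.

Lemma smooth_on_mx V p q (U : set V) (f : V -> 'M[R]_(p, q)) : open U ->
  (forall i j, smooth_on U (fun x => f x i j)) -> smooth_on U f.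
Proof.
move=> oU sf.
apply: (@smooth_on_coind _ _ U (fun h : V -> 'M[R]_(p, q) =>
  forall i j, smooth_on U (fun x => h x i j)) _ f) => // h sh.
have dh x : U x -> differentiable h x.
  by move=> Ux; apply/differentiable_mxP => i j; apply: smooth_on_diff (sh i j) Ux.
split=> // v i j; apply: (smooth_on_eq oU _ (smooth_on_derive v (sh i j))).
by move=> x Ux; rewrite derive_coord//; exact: dh.
Qed.

Lemma smooth_on_entry p q (U : set 'M[R]_(p, q)) i j :
  smooth_on U (fun Y : 'M[R]_(p, q) => Y i j).
Proof.
apply: smooth_on_intro => [Y _|v]; first exact: differentiable_coord.
have -> : 'D_v (fun Y : 'M[R]_(p, q) => Y i j : R) = cst (v i j).
  by apply/funext => x; rewrite (@derive_coord _ _ _ id)// derive_id.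
exact: smooth_on_cst.
Qed.

Lemma derive_entry p q (Y v : 'M[R]_(p, q)) i j :
  'D_v (fun Y : 'M[R]_(p, q) => Y i j : R) Y = v i j.
Proof. by rewrite (@derive_coord _ _ _ id)// derive_id. Qed.

End Smooth.

(** * Linear maps and derivatives along vector fields *)

Lemma eq_derive_dir (R : realType) (V W : normedModType R) (f g : V -> W) x y v w :
  (forall h : R, f (h *: v + x) = g (h *: w + y)) -> 'D_v f x = 'D_w g y.
Proof.
move=> fg; have := fg 0; rewrite !scale0r !add0r => fg0.
rewrite /derive /= fg0; suff -> : (fun h : R => h^-1 *: (f (h *: v + x) - g y)) =
  (fun h => h^-1 *: (g (h *: w + y) - g y)) by [].
by apply/funext => h; rewrite fg.
Qed.

Section LinearMaps.
Context {R : realType} {p q : nat}.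

Lemma linear_mx_diff (W : normedModType R) (F : 'M[R]_(p, q) -> W) Y : linear F ->
  differentiable F Y.
Proof.
move=> lF; pose F' : {linear _ -> _} := HB.pack F (GRing.isLinear.Build _ _ _ _ _ lF).
have -> : F = fun Z => \sum_i \sum_j Z i j *: F (delta_mx i j).
  apply/funext => Z; rewrite -[F Z]/(F' Z) {1}(matrix_sum_delta Z) linear_sum.
  by apply: eq_bigr => i _; rewrite linear_sum; apply: eq_bigr => j _; rewrite linearZ.
apply: differentiable_sumf => i; apply: differentiable_sumf => j.
apply: (@differentiableZl _ _ _ (fun Z : 'M[R]_(p, q) => Z i j)).
exact: differentiable_coord.
Qed.

Lemma derive_linear_mx (W : normedModType R) (F : 'M[R]_(p, q) -> W) Y v : linear F ->
  'D_v F Y = F v.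
Proof.
move=> lF; pose F' : {linear _ -> _} := HB.pack F (GRing.isLinear.Build _ _ _ _ _ lF).
have cF : continuous F' by move=> Z; exact/differentiable_continuous/linear_mx_diff.
rewrite deriveE; last exact: linear_mx_diff.
by rewrite -[F]/(F' : _ -> _) diff_lin.
Qed.

Lemma linear_mx_continuous (W : normedModType R) (F : 'M[R]_(p, q) -> W) :
  linear F -> continuous F.
Proof. by move=> lF Y; exact/differentiable_continuous/linear_mx_diff. Qed.

End LinearMaps.

Section AlongField.
Context {R : realType} {p q : nat}.

(** In coordinates, the derivative along a field is the sum of its components
    times partial derivatives. *)
Lemma smooth_on_along (U : set 'M[R]_(p, q)) (f : 'M[R]_(p, q) -> R)
    (A : 'M[R]_(p, q) -> 'M[R]_(p, q)) : open U -> smooth_on U f -> smooth_on U A ->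
  smooth_on U (fun Y => 'D_(A Y) f Y).
Proof.
move=> oU sf sA; apply: smooth_termP => //.
apply: (@term_eq _ _ _ (fun Y => \sum_i \sum_j A Y i j * 'D_(delta_mx i j) f Y)).
  by move=> Y UY; rewrite (derive_basis _ (smooth_on_diff sf UY)).
apply: term_sum => i; apply: term_sum => j; apply: term_mul; apply: term_smooth.
  exact: smooth_on_coord.
exact: smooth_on_derive.
Qed.

Lemma smooth_on_linear (W : normedModType R) (U : set 'M[R]_(p, q)) (A : 'M[R]_(p, q) -> W) :
  linear A -> smooth_on U A.
Proof.
move=> lA; apply: smooth_on_intro => [Y _|v]; first exact: linear_mx_diff.
have -> : 'D_v A = cst (A v) by apply/funext => Y; exact: derive_linear_mx.
exact: smooth_on_cst.
Qed.

Lemma open_preimage (T T' : topologicalType) (A : set T) (O : set T') (g : T -> T') :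
  open A -> (forall x, A x -> {for x, continuous g}) -> open O ->
  open (A `&` g @^-1` O).
Proof.
move=> oA cg oO; rewrite openE => x [Ax Ox]; apply: filterI.
  exact: open_nbhs_nbhs.
exact: (cg x Ax _ (open_nbhs_nbhs (conj oO Ox))).
Qed.

End AlongField.

(** * Symmetry of second derivatives, commutators of vector fields *)

Section Schwarz.
Context {R : realType}.
Implicit Types V W : normedModType R.

Lemma is_derive_line V W (f : V -> W) z v (s : R) : differentiable f (s *: v + z) ->
  is_derive s (1 : R) (fun s => f (s *: v + z)) ('D_v f (s *: v + z)).
Proof.
move=> df.
have da : is_diff s (fun s : R => s *: v + z) (fun s => s *: v).
  have h : is_diff s (fun s : R => s *: v) (fun s => s *: v) by exact: is_diff_scalel.
  have := is_diffD h (is_diff_cst z s); rewrite addr0; exact.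
have dc : differentiable (fun s : R => f (s *: v + z)) s.
  by apply: (@differentiable_comp _ _ _ _ (fun s : R => s *: v + z) f s).
apply: DeriveDef; first exact: diff_derivable.
rewrite (@derive_comp _ _ _ _ f (fun s : R => s *: v + z))//.
by rewrite [X in 'D_X f _]deriveE// diff_val scale1r.
Qed.

Definition second_difference V (f : V -> R) x v w (t : R) :=
  f (x + t *: v + t *: w) - f (x + t *: v) - (f (x + t *: w) - f x).

Lemma second_differenceC V (f : V -> R) x v w t :
  second_difference f x v w t = second_difference f x w v t.
Proof. by rewrite /second_difference [x + t *: v + _]addrAC; ring. Qed.

(** The mean value theorem in the direction [v] turns the second difference
    into [t] times an increment of ['D_v f], and the differentiability of
    ['D_v f] at [x] evaluates this increment. *)
Lemma second_difference_approx V (f : V -> R) x v w :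
  (\forall y \near x, differentiable f y) -> differentiable ('D_v f) x ->
  forall e : R, 0 < e -> exists2 d : R, 0 < d & forall t, 0 < t < d ->
    `|second_difference f x v w t - t ^+ 2 * 'D_w ('D_v f) x| <= e * t ^+ 2.
Proof.
move=> /nbhs_ballP[d1 /= d10 Hd1] dg e e0.
set g := 'D_v f in dg *; set k := `|v| + `|w| + 1.
have k0 : 0 < k by rewrite /k ltr_wpDl// addr_ge0.
pose e' := e / (2 * k).
have e'0 : 0 < e' by rewrite /e' divr_gt0// mulr_gt0.
have : \forall h \near (0 : V), `|g (h + x) - g x - 'd g x h| <= e' * `|h|.
  have /eqaddoP/(_ e' e'0) := diff_locally dg.
  by apply: filterS => h; rewrite /= !fctE /= opprD addrA.
move=> /nbhs_ballP[d2 /= d20 Hd2].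
have small h (d t : R) : 0 < t -> t < d / k -> `|h| <= t * (`|v| + `|w|) -> ball (0 : V) d h.
  move=> t0 td hle; rewrite -ball_normE /= sub0r normrN.
  rewrite (le_lt_trans hle)// (@le_lt_trans _ _ (t * k))//; last by rewrite -ltr_pdivlMr.
  by rewrite ler_wpM2l ?(ltW t0)// /k lerDl.
exists (Num.min d1 d2 / k); first by rewrite divr_gt0// lt_min d10.
move=> t /andP[t0 td].
have td1 : t < d1 / k by rewrite (lt_le_trans td)// ler_pM2r ?invr_gt0// ge_min lexx.
have td2 : t < d2 / k by rewrite (lt_le_trans td)// ler_pM2r ?invr_gt0// ge_min lexx orbT.
have nle (a s : R) : 0 <= s <= t -> 0 <= a <= t ->
    `|s *: v + a *: w| <= t * (`|v| + `|w|).
  move=> /andP[s0 st] /andP[a0 at_]; rewrite (le_trans (ler_normD _ _))// !normrZ.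
  by rewrite !ger0_norm// mulrDr lerD// ler_wpM2r.
(* The second difference is an increment of phi over the segment from 0 to t. *)
pose phi (s : R) := f (s *: v + (x + t *: w)) - f (s *: v + x).
have inb s a : 0 <= s <= t -> 0 <= a <= t -> differentiable f (s *: v + (x + a *: w)).
  move=> st ta; apply: Hd1; have := small _ _ _ t0 td1 (nle a s st ta).
  rewrite -!ball_normE /= sub0r normrN => h.
  by rewrite [s *: v + (x + _)]addrCA opprD addrA subrr sub0r normrN.
have dphi s : 0 <= s <= t ->
    is_derive s (1 : R) phi (g (s *: v + (x + t *: w)) - g (s *: v + x)).
  move=> st; apply: is_deriveB; apply: is_derive_line.
    by apply: inb => //; rewrite lexx ltW.
  by have := inb s 0 st; rewrite scale0r addr0; apply; rewrite lexx ltW.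
have cphi : {within `[0, t], continuous phi}.
  apply: derivable_within_continuous => s; rewrite in_itv /= => st.
  by have [] := dphi s st.
have [|th] := @MVT R phi (fun s => g (s *: v + (x + t *: w)) - g (s *: v + x)) 0 t t0 _ cphi.
  by move=> s; rewrite in_itv /= => /andP[s0 st]; apply: dphi; rewrite !ltW.
rewrite in_itv /= subr0 => /andP[th0 tht] E.
have -> : second_difference f x v w t = phi t - phi 0.
  rewrite /second_difference /phi scale0r !add0r.
  by rewrite [t *: v + (x + _)]addrA [t *: v + x]addrC.
have thr : 0 <= th <= t by rewrite !ltW.
have tr : 0 <= t <= t by rewrite lexx ltW.
have zr : 0 <= (0:R) <= t by rewrite lexx ltW.
have B1 := Hd2 _ (small _ _ _ t0 td2 (nle t th thr tr)).
have B2 := Hd2 _ (small _ _ _ t0 td2 (nle 0 th thr zr)).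
have L1 := nle t th thr tr; have L2 := nle 0 th thr zr.
rewrite scale0r addr0 in B2 L2.
rewrite E deriveE// mulrC expr2 -mulrA -mulrBr normrM gtr0_norm// mulrCA.
rewrite ler_pM2l//.
have -> : t * 'd g x w = 'd g x (th *: v + t *: w) - 'd g x (th *: v).
  by rewrite -linearB /= addrC addKr linearZ.
set A := g _ - g x - _ in B1; set B := g _ - g x - _ in B2.
have -> : g (th *: v + (x + t *: w)) - g (th *: v + x) -
     ('d g x (th *: v + t *: w) - 'd g x (th *: v)) = A - B.
  by rewrite /A /B -[th *: v + t *: w + x]addrA [t *: w + x]addrC; ring.
rewrite (le_trans (ler_normB _ _))//.
apply: le_trans (_ : e' * (t * (`|v| + `|w|)) + e' * (t * (`|v| + `|w|)) <= _).
  by rewrite lerD// (le_trans B1, le_trans B2)// ler_pM2l.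
have -> : e' * (t * (`|v| + `|w|)) + e' * (t * (`|v| + `|w|)) =
    e * t * ((`|v| + `|w|) / k) by rewrite /e'; field; rewrite gt_eqF.
rewrite -[leRHS]mulr1 ler_pM2l ?mulr_gt0// ler_pdivrMr// mul1r.
by rewrite /k lerDl.
Qed.

Lemma slope_dist_le (a b S u e : R) : 0 < u ->
  `|S - u * a| <= e / 2 * u -> `|S - u * b| <= e / 2 * u -> `|a - b| <= e.
Proof.
move=> u0 Ha Hb; rewrite -(ler_pM2r u0) -{1}(gtr0_norm u0) -normrM.
have -> : (a - b) * u = - (S - u * a) + (S - u * b) by ring.
by rewrite (le_trans (ler_normD _ _))// normrN (splitr e) mulrDl lerD.
Qed.

(** Both mixed derivatives are the limit of the second difference divided by
    [t ^+ 2], and the second difference is symmetric. *)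
Lemma derive_sym V (f : V -> R) x v w :
  (\forall y \near x, differentiable f y) ->
  differentiable ('D_v f) x -> differentiable ('D_w f) x ->
  'D_w ('D_v f) x = 'D_v ('D_w f) x.
Proof.
move=> df dv dw; apply/eqP; rewrite -subr_eq0 -normr_le0; apply/ler_addgt0Pr => e e0.
rewrite add0r.
have e20 : 0 < e / 2 by rewrite divr_gt0.
have [d1 d10 H1] := second_difference_approx w df dv e20.
have [d2 d20 H2] := second_difference_approx v df dw e20.
pose t := Num.min d1 d2 / 2.
have t0 : 0 < t by rewrite divr_gt0// lt_min d10.
have tm : t < Num.min d1 d2 by rewrite /t ltr_pdivrMr// mulr2n mulrDr mulr1 ltrDl lt_min d10.
have [] : t < d1 /\ t < d2 by split; rewrite (lt_le_trans tm)// ge_min lexx ?orbT.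
move=> td1 td2.
have := H1 t; rewrite t0 td1 => /(_ isT) {}H1.
have := H2 t; rewrite t0 td2 second_differenceC => /(_ isT) {}H2.
exact: slope_dist_le (exprn_gt0 2 t0) H1 H2.
Qed.

Lemma smooth_derive_sym V (U : set V) (f : V -> R) x v w : open U -> smooth_on U f ->
  U x -> 'D_w ('D_v f) x = 'D_v ('D_w f) x.
Proof.
move=> oU sf Ux; apply: derive_sym.
- by near=> y; apply: smooth_on_diff sf _; near: y; exact: open_nbhs_nbhs.
- exact: smooth_on_diff (smooth_on_derive v sf) Ux.
- exact: smooth_on_diff (smooth_on_derive w sf) Ux.
Unshelve. all: by end_near. Qed.

(** The derivative hits either the field [B] or the function; by symmetry of
    second derivatives the direction [v] can then be moved inside. *)
Lemma derive_along p q (f : 'M[R]_(p, q) -> R) (U : set 'M[R]_(p, q))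
    (B : 'M[R]_(p, q) -> 'M[R]_(p, q)) Y v : open U -> smooth_on U f -> U Y ->
  differentiable B Y ->
  'D_v (fun Z => 'D_(B Z) f Z) Y = 'D_('D_v B Y) f Y + 'D_(B Y) ('D_v f) Y.
Proof.
move=> oU sf UY dB.
have dE i j : differentiable ('D_(delta_mx i j) f) Y.
  exact: smooth_on_diff (smooth_on_derive _ sf) UY.
have dBc i j : differentiable (fun Z => B Z i j) Y by move: i j; exact/differentiable_mxP.
rewrite (@near_eq_derive _ _ _ _
  (\sum_i (\sum_j (fun Z => B Z i j * 'D_(delta_mx i j) f Z)))); last first.
  near=> Z; rewrite fct_sumE derive_basis; last first.
    by apply: smooth_on_diff sf _; near: Z; exact: open_nbhs_nbhs.
  by apply: eq_bigr => i _; rewrite fct_sumE.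
rewrite derive_sum; last first.
  by move=> i; apply: derivable_sum => j; apply/derivableM; exact: diff_derivable.
rewrite (derive_basis ('D_v B Y)); last exact: smooth_on_diff UY.
rewrite (derive_basis (B Y)); last exact: smooth_on_diff (smooth_on_derive _ sf) UY.
rewrite -big_split; apply: eq_bigr => i _ /=.
rewrite derive_sum; last by move=> j; apply/derivableM; exact: diff_derivable.
rewrite -big_split; apply: eq_bigr => j _ /=.
rewrite (@deriveM _ _ (fun Z => B Z i j) ('D_(delta_mx i j) f) Y v
  (diff_derivable (dBc i j)) (diff_derivable (dE i j))).
rewrite (derive_coord _ _ _ dB) (smooth_derive_sym (delta_mx i j) v oU sf UY).
rewrite addrC; congr (_ + _); exact: mulrC.
Unshelve. all: by end_near. Qed.

Lemma subrDr2 (a b c : R) : a + b - (c + b) = a - c.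
Proof. by rewrite opprD addrACA subrr addr0. Qed.

(** The second-order terms of the two composites cancel by symmetry: the
    commutator of two vector fields is a vector field. *)
Lemma derive_commutator p q (f : 'M[R]_(p, q) -> R) (U : set 'M[R]_(p, q))
    (A B : 'M[R]_(p, q) -> 'M[R]_(p, q)) Y : open U -> smooth_on U f -> U Y ->
  differentiable A Y -> differentiable B Y ->
  'D_(A Y) (fun Z => 'D_(B Z) f Z) Y - 'D_(B Y) (fun Z => 'D_(A Z) f Z) Y =
  'D_('D_(A Y) B Y - 'D_(B Y) A Y) f Y.
Proof.
move=> oU sf UY dA dB; rewrite (derive_along (A Y) oU sf UY dB) (derive_along (B Y) oU sf UY dA).
have df := smooth_on_diff sf UY.
rewrite (smooth_derive_sym (B Y) (A Y) oU sf UY) (deriveDdir _ _ df).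
rewrite (deriveNdir _ df); exact: subrDr2.
Qed.

End Schwarz.

(** * Prolongation of a map to jet coordinates *)

Section Prolongation.
Context {R : realType} {n m : nat}.
Local Notation coords := 'M[R]_(n.+1, m).
Implicit Types (Y Z : coords) (tau : 'rV[R]_m -> R).

(** The total derivative [y_r |-> y_(r+1)] as a vector field on jet coordinates.
    The derivative of the top row lies outside the jet space and is replaced
    by [0]; this is harmless on functions of order less than [n]. *)
Definition total Y : coords :=
  \matrix_(r, i) if (r < n)%N then Y (inord r.+1) i else 0.

Lemma total_linear : linear total.
Proof.
move=> a Y Z; apply/matrixP => r i; rewrite !mxE.
by case: ifP; rewrite ?mxE// mulr0 addr0.
Qed.

Lemma Delta_comp_linear r : linear (@Delta_comp R m n r).
Proof.
move=> a Y Z; apply/matrixP => s i; rewrite !mxE.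
by case: ifP => _; rewrite ?mulr0 ?addr0// mulrDr; congr (_ + _); rewrite mulrCA.
Qed.

Lemma row_linear (r : 'I_n.+1) : linear (fun Y : coords => row r Y).
Proof. by move=> a Y Z; rewrite linearP. Qed.

Definition over (O : set 'rV[R]_m) : set coords := [set Y | O (row ord0 Y)].

Lemma over_open O : open O -> open (over O).
Proof.
move=> oO; apply: (@open_comp _ _ (fun Y : coords => row ord0 Y)) => // Y _.
exact: (linear_mx_continuous (row_linear ord0)).
Qed.

(** [prol s tau] expresses the [s]-th derivative of [tau (y x)] through the
    derivatives of [y] (see [prol_curve]). Iterating the total derivative
    gives the Faa di Bruno polynomials without writing their coefficients. *)
Fixpoint prol (s : nat) tau Y : R :=
  if s is s'.+1 then 'D_(total Y) (prol s' tau) Y else tau (row ord0 Y).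

Lemma prolS s tau Y : prol s.+1 tau Y = 'D_(total Y) (prol s tau) Y.
Proof. by []. Qed.

Definition agree_to (s : nat) Y Z := forall (r : 'I_n.+1) i, (r <= s)%N -> Y r i = Z r i.

Lemma agree_total s Y Z : agree_to s.+1 Y Z -> agree_to s (total Y) (total Z).
Proof.
move=> YZ r i rs; rewrite !mxE; case: ifP => // rn.
by apply: YZ; rewrite inordK.
Qed.

(** [prol s tau] has order [s]; hence truncating the total derivative at the
    top row changes nothing up to [s = n]. *)
Lemma prol_agree s tau Y Z : agree_to s Y Z -> prol s tau Y = prol s tau Z.
Proof.
elim: s Y Z => [|s IH] Y Z YZ /=.
  by congr tau; apply/matrixP => i j; rewrite !mxE YZ.
apply: eq_derive_dir => h; apply: IH.
by move=> r i rs; rewrite !mxE (YZ r i) ?(leqW rs)//; have := @agree_total _ _ _ YZ r i rs; rewrite !mxE => ->.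
Qed.

Lemma derive_prol_agree s tau Y v w : agree_to s v w ->
  'D_v (prol s tau) Y = 'D_w (prol s tau) Y.
Proof.
move=> vw; apply: eq_derive_dir => h; apply: prol_agree.
by move=> r i rs; rewrite !mxE (vw r i rs).
Qed.

Lemma prol_smooth s tau O : open O -> smooth_on O tau -> smooth_on (over O) (prol s tau).
Proof.
move=> oO st; have oV := over_open oO.
elim: s => [|s IH].
  apply: smooth_termP => //.
  apply: (@term_comp _ _ _ _ _ O tau (fun Y : coords => row ord0 Y)) => // i j.
  apply: (@term_eq _ _ _ (fun Y : coords => Y ord0 j)) => [Y _|]; first by rewrite mxE.
  exact/term_smooth/smooth_on_entry.
exact: (smooth_on_along oV IH (smooth_on_linear total_linear)).
Qed.

Lemma smooth_derive1n (W : normedModType R) (U : set R) (g : R -> W) r :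
  smooth_on U g -> smooth_on U (derive1n r g).
Proof.
move=> sg; elim: r => // r IH.
have -> : derive1n r.+1 g = 'D_1 (derive1n r g).
  by apply/funext => x; rewrite derive1nS derive1E.
exact: smooth_on_derive.
Qed.

Definition curve_jet (g : R -> 'rV[R]_m) (x : R) : coords :=
  \matrix_(r, i) derive1n r g x 0 i.

(** Along [x |-> curve_jet g x] the velocity is the total derivative, except in
    the top row, which [prol s tau] does not see for [s < n]. *)
Lemma prol_curve (U : set R) (O : set 'rV[R]_m) g tau s x :
  open U -> open O -> smooth_on U g -> smooth_on O tau ->
  (forall t, U t -> O (g t)) -> (s <= n)%N -> U x ->
  derive1n s (fun t => tau (g t)) x = prol s tau (curve_jet g x).
Proof.
move=> oU oO sg st gO.
have cj t : U t -> row ord0 (curve_jet g t) = g t.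
  by move=> _; apply/rowP => i; rewrite !mxE.
elim: s x => [|s IH] x sn Ux; first by rewrite /= cj.
have dJ : differentiable (curve_jet g) x.
  apply/differentiable_mxP => r i.
  have -> : (fun y => curve_jet g y r i) = (fun y => derive1n r g y 0 i).
    by apply/funext => y; rewrite mxE.
  move: (0 : 'I_1) i; apply/differentiable_mxP.
  exact: smooth_on_diff (smooth_derive1n r sg) Ux.
have dp : differentiable (prol s tau) (curve_jet g x).
  by apply: smooth_on_diff (prol_smooth s oO st) _; rewrite /over /= cj//; exact: gO.
rewrite derive1nS derive1E.
rewrite (@near_eq_derive _ _ _ _ (fun t => prol s tau (curve_jet g t))); last first.
  apply: open_near_eq oU Ux _ => t Ut; exact: IH (ltnW sn) Ut.
rewrite (derive_comp _ dJ dp) /=; apply: derive_prol_agree => r i rs.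
rewrite -(derive_coord _ _ _ dJ) mxE (leq_ltn_trans rs sn) mxE.
rewrite inordK; last by rewrite ltnS (leq_ltn_trans rs sn).
rewrite derive1nS derive1E -derive_coord; last first.
  exact: smooth_on_diff (smooth_derive1n r sg) Ux.
by apply: eq_derive_dir => h; exact: mxE.
Qed.

Lemma Delta_compE r Y (s : 'I_n.+1) i : Delta_comp r Y s i =
  if (r <= s)%N then s`!%:R / (s - r)`!%:R * Y (inord (s + 1 - r)) i else 0.
Proof. by rewrite mxE. Qed.

Lemma totalE Y (r : 'I_n.+1) i : (r < n)%N -> total Y r i = Y (inord r.+1) i.
Proof. by move=> rn; rewrite mxE rn. Qed.

Lemma factR_neq0 (l : nat) : (l`!)%:R != 0 :> R.
Proof. by rewrite pnatr_eq0 -lt0n fact_gt0. Qed.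

(** The commutator [[Delta^(r+1), d/dx] = (r+1) Delta^r]. In the rows below the
    top one, the formula of [Delta_comp] at [0] is the total derivative, so
    that the case [r = 0] is included. *)
Lemma total_Delta s r Y : (s < n)%N ->
  agree_to s (total (Delta_comp r.+1 Y) - Delta_comp r.+1 (total Y))
             (r.+1%:R *: Delta_comp r Y).
Proof.
move=> sn k i ks; have kn := leq_ltn_trans ks sn.
have -> : (total (Delta_comp r.+1 Y) - Delta_comp r.+1 (total Y)) k i =
  total (Delta_comp r.+1 Y) k i - Delta_comp r.+1 (total Y) k i.
  by rewrite mxE [X in _ + X]mxE.
have -> : (r.+1%:R *: Delta_comp r Y) k i = r.+1%:R * Delta_comp r Y k i.
  by rewrite mxE.
rewrite totalE// !Delta_compE inordK ?ltnS// !addn1 !subSS.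
have [rk|kr] := leqP r k; last first.
  by rewrite ltnNge (ltnW kr) /= subr0 mulr0.
have [d Ed] : exists d, nat_of_ord k = (r + d)%N by exists (k - r)%N; rewrite subnKC.
case: d Ed => [|d] Ed.
  rewrite Ed addn0 ltnn subnn subr0 factS natrM.
  by rewrite subSn// subnn -!mulrA.
have rk' : (r < k)%N by rewrite Ed addnS ltnS leq_addr.
have -> : (k.+1 - r = d.+2)%N by rewrite Ed -!addnS addKn.
have -> : (k - r = d.+1)%N by rewrite Ed addKn.
have -> : (k - r.+1 = d)%N by rewrite Ed addnS subSS addKn.
have dn : (d.+1 < n)%N by rewrite (leq_ltn_trans _ kn)// Ed leq_addl.
rewrite rk' totalE inordK ?ltnS ?(ltnW dn)//.
set y := Y _ i; rewrite Ed !factS !natrM.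
have := factR_neq0 d; have := factR_neq0 (r + d); set u := (d`!)%:R; set w := _%:R.
move=> _ u0; have d0 : (d.+1)%:R != 0 :> R by rewrite pnatr_eq0.
rewrite -addnS -(addn1 d) -(addn1 r) !natrD.
rewrite -(addn1 d) natrD in d0.
by field; rewrite u0 d0.
Qed.

(** Prolongations are differentiated by [Delta^r] as the coordinates [y_s] are:
    this is the invariance of [Delta^r] under changes of chart. The induction
    on [s] moves [Delta^r] across one total derivative by [total_Delta]. *)
Lemma prol_Delta s r tau O Y : open O -> smooth_on O tau -> over O Y -> (s <= n)%N ->
  (0 < r)%N ->
  'D_(Delta_comp r Y) (prol s tau) Y =
  if (r <= s)%N then s`!%:R / (s - r)`!%:R * prol (s + 1 - r) tau Y else 0.
Proof.
move=> oO st; have oV := over_open oO.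
case: r => // r; elim: s r Y => [|s IH] r Y OY sn _.
  rewrite (@derive_prol_agree 0 tau Y _ 0) ?derive0// => k i.
  rewrite leqn0 => /eqP k0; rewrite Delta_compE k0 mxE.
  by [].
have sp := prol_smooth s oO st.
have dp := smooth_on_diff sp OY.
have := @derive_commutator R _ _ (prol s tau) _ (Delta_comp r.+1) total Y oV sp OY
  (linear_mx_diff _ (Delta_comp_linear _)) (linear_mx_diff _ total_linear).
rewrite (derive_linear_mx _ _ total_linear) (derive_linear_mx _ _ (Delta_comp_linear _)).
rewrite (derive_prol_agree _ _ (total_Delta _ _ sn)) (deriveZdir _ _ dp).
move=> /eqP; rewrite subr_eq => /eqP ->.
have E1 : 'D_(total Y) (fun Z => 'D_(Delta_comp r.+1 Z) (prol s tau) Z) Y =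
    if (r < s)%N then s`!%:R / (s - r.+1)`!%:R * prol (s + 1 - r) tau Y else 0.
  rewrite (@near_eq_derive _ _ _ _ (fun Z => if (r < s)%N then
      s`!%:R / (s - r.+1)`!%:R * prol (s - r) tau Z else 0)); last first.
    apply: (open_near_eq oV OY) => Z OZ; rewrite (IH r Z OZ (ltnW sn))//.
    by rewrite addn1 subSS.
  case: ifP => rs; last by rewrite derive_cst.
  rewrite addn1 subSn ?(ltnW rs)// deriveMl.
    by [].
  exact: diff_derivable (smooth_on_diff (prol_smooth _ oO st) OY).
rewrite E1.
have E2 : 'D_(Delta_comp r Y) (prol s tau) Y =
    if (r <= s)%N then s`!%:R / (s - r)`!%:R * prol (s + 1 - r) tau Y else 0.
  case: r {E1} => [|r]; last exact: IH (ltnW sn) _.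
  rewrite (@derive_prol_agree s tau Y _ (total Y)).
    by rewrite subn0 divff ?factR_neq0// mul1r subn0 addn1.
  move=> k i ks; rewrite Delta_compE subn0 divff ?factR_neq0// mul1r subn0 addn1.
  by rewrite totalE// (leq_ltn_trans ks).
rewrite E2 ltnS; have [rs|sr] := leqP r s; last first.
  by rewrite ltnNge (ltnW sr) /= scaler0 addr0.
have [d Ed] : exists d, s = (r + d)%N by exists (s - r)%N; rewrite subnKC.
rewrite !subSS.
set P := prol _ _ _; rewrite -[_ *: _]/(_ * _).
case: d Ed => [|d] Ed.
  by rewrite Ed addn0 ltnn subnn addr0 factS natrM -!mulrA.
have rs' : (r < s)%N by rewrite Ed addnS ltnS leq_addr.
have -> : (s - r = d.+1)%N by rewrite Ed addKn.
have -> : (s - r.+1 = d)%N by rewrite Ed addnS subSS addKn.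
rewrite rs' Ed !factS !natrM.
have u0 := factR_neq0 d; set u := (d`!)%:R in u0 *; set w := ((r + d.+1)`!)%:R.
have d0 : (d.+1)%:R != 0 :> R by rewrite pnatr_eq0.
rewrite -(addn1 (r + _)) -(addn1 d) -(addn1 r) !natrD.
rewrite -(addn1 d) natrD in d0.
by field; rewrite u0 d0.
Qed.

End Prolongation.

(** * Taylor curves and charts *)

Section OneVariable.
Context {R : realType}.

Lemma derive1n_eq (W : normedModType R) (U : set R) (f g : R -> W) s x : open U ->
  (forall t, U t -> f t = g t) -> U x -> derive1n s f x = derive1n s g x.
Proof.
move=> oU fg; elim: s x => [|s IH] x Ux; first exact: fg.
rewrite !derive1nS !derive1E; apply: near_eq_derive; exact: open_near_eq oU Ux IH.
Qed.

Lemma derive1n_coord p q (U : set R) (f : R -> 'M[R]_(p, q)) s x i j : open U ->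
  smooth_on U f -> U x -> derive1n s (fun t => f t i j) x = derive1n s f x i j.
Proof.
move=> oU sf; elim: s x => [|s IH] x Ux //.
rewrite !derive1nS !derive1E -derive_coord; last first.
  exact: smooth_on_diff (smooth_derive1n s sf) Ux.
by apply: near_eq_derive; exact: open_near_eq oU Ux IH.
Qed.

(** In one variable ['D_v] is [v] times the ordinary derivative. *)
Lemma smooth_on_R (W : normedModType R) (U : set R) (f : R -> W) : open U ->
  (forall k x, U x -> differentiable (derive1n k f) x) -> smooth_on U f.
Proof.
move=> oU df.
apply: (@smooth_on_coind _ _ _ U (fun h : R -> W => exists (a : R) k,
    forall x, U x -> a *: derive1n k f x = h x)); last first.
  by exists 1, 0%N => x _; rewrite scale1r.
move=> h [a [k E]]; split=> [x Ux|v].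
  apply: near_eq_differentiable (open_near_eq oU Ux E) _.
  by apply: (@differentiableZ _ _ _ (derive1n k f)); exact: df.
exists (a * v), k.+1 => x Ux.
rewrite -(near_eq_derive _ (open_near_eq oU Ux E)).
rewrite (@deriveZ _ _ _ (derive1n k f)); last exact/diff_derivable/df.
rewrite derive1nS derive1E -scalerA -deriveZdir; last exact: df.
by rewrite -[v *: 1]/(v * 1) mulr1.
Qed.

End OneVariable.

Section TaylorCurve.
Context {R : realType} {n m : nat}.
Variable Y : 'M[R]_(n.+1, m).

(** The [k]-th derivative of the polynomial with derivatives [Y] at [0], written
    so that differentiating it raises [k]. *)
Definition taylor_entry (k : nat) i (t : R) : R :=
  \sum_(r < n.+1) if (k <= r)%N then (t ^+ (r - k) / (r - k)`!%:R) * Y r i else 0.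

Definition taylor_curve (k : nat) (t : R) : 'rV[R]_m := \row_i taylor_entry k i t.

Lemma taylor_coef (a x : R) d :
  (a / (d.+1`!)%:R) * (d.+1%:R * x * 1) = x / (d`!)%:R * a.
Proof.
have := factR_neq0 (R := R) d; rewrite factS natrM => f0.
have d0 : d.+1%:R != 0 :> R by rewrite pnatr_eq0.
move: (d.+1%:R : R) d0 (d`!%:R : R) f0 => e e0 u u0.
by field; rewrite e0 u0.
Qed.

Lemma taylor_entry_derive k i t :
  is_derive t (1 : R) (taylor_entry k i) (taylor_entry k.+1 i t).
Proof.
have -> : taylor_entry k i = \sum_(r < n.+1) fun t =>
    if (k <= r)%N then (t ^+ (r - k) / (r - k)`!%:R) * Y r i else 0.
  by apply/funext => u; rewrite fct_sumE.
apply: is_derive_sum => r.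
have [kr|rk] := leqP k r; last first.
  by rewrite ltnNge (ltnW rk) /=; exact: is_derive_cst.
have [kr'|rk] := ltnP k r; last first.
  have -> : (r - k = 0)%N by apply/eqP; rewrite subn_eq0.
  have -> : (fun x : R => x ^+ 0 / (0`!)%:R * Y r i) = cst (1 / (0`!)%:R * Y r i).
    by apply/funext => x; rewrite expr0.
  exact: is_derive_cst.
have -> : (r - k = (r - k.+1).+1)%N by rewrite subnSK.
set d := (r - k.+1)%N.
have -> : (fun x : R => x ^+ d.+1 / (d.+1`!)%:R * Y r i) =
    (Y r i / (d.+1`!)%:R) *: (fun x : R => x ^+ d.+1).
  by apply/funext => x; rewrite /= mulrC mulrA mulrAC.
have dx : derivable (fun x : R => x ^+ d.+1) t 1 by exact: exprn_derivable.
apply: DeriveDef; first exact: derivableZ.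
by rewrite (deriveZ _ dx) exp_derive; exact: taylor_coef.
Qed.

Lemma derive1n_taylor k : derive1n k (taylor_curve 0) = taylor_curve k.
Proof.
elim: k => // k IH; rewrite derive1nS IH; apply/funext => t; rewrite derive1E.
have dk : differentiable (taylor_curve k) t.
  apply/differentiable_mxP => i j.
  have -> : (fun y => taylor_curve k y i j) = taylor_entry k j.
    by apply/funext => y; rewrite mxE.
  by apply/derivable1_diffP; have [] := taylor_entry_derive k j t.
apply/rowP => j; rewrite -(derive_coord _ _ _ dk) mxE.
have -> : (fun y => taylor_curve k y 0 j) = taylor_entry k j.
  by apply/funext => y; rewrite mxE.
by have [_] := taylor_entry_derive k j t.
Qed.

Lemma taylor_curve0 (r : 'I_n.+1) : taylor_curve r 0 = row r Y.
Proof.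
apply/rowP => i; rewrite !mxE /taylor_entry (bigD1 r)//= leqnn subnn expr0 divr1 mul1r.
rewrite big1 ?addr0// => s sr; case: ifP => // rs.
have -> : (0 : R) ^+ (s - r) = 0.
  by rewrite expr0n subn_eq0 leqNgt ltn_neqAle rs eq_sym sr.
by rewrite !mul0r.
Qed.

Lemma taylor_curve_smooth U : open U -> smooth_on U (taylor_curve 0).
Proof.
move=> oU; apply: smooth_on_R => // k x _; rewrite derive1n_taylor.
apply/differentiable_mxP => i j.
have -> : (fun y => taylor_curve k y i j) = taylor_entry k j.
  by apply/funext => y; rewrite mxE.
by apply/derivable1_diffP; have [] := taylor_entry_derive k j x.
Qed.

End TaylorCurve.

Section Charts.
Context {R : realType} {m : nat} {M : manifold R m}.
Implicit Types (c d : chart R m M) (O : set M).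

Definition chart_im c : set 'rV[R]_m := chart_map c @` chart_dom c.

Definition transition c d (y : 'rV[R]_m) : 'rV[R]_m := chart_map d (chart_inv c y).

Lemma chart_imE c O : chart_map c @` (chart_dom c `&` O) =
  [set y | chart_im c y /\ O (chart_inv c y)].
Proof.
apply/seteqP; split=> [_ [p [cp Op] <-]|_ [[p cp <-]]] /=; last first.
  by rewrite chart_mapK// => Op; exists p.
by split; [exists p|rewrite chart_mapK].
Qed.

Lemma chart_im_over_open c O : open O -> open (chart_map c @` (chart_dom c `&` O)).
Proof.
move=> oO; rewrite chart_imE openE => y [cy Oy].
have ci : nbhs y (chart_im c) by apply: open_nbhs_nbhs; split=> //; exact: chart_im_open.
have Oi := chart_inv_cts cy (open_nbhs_nbhs (conj oO Oy)).
exact: filterI ci Oi.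
Qed.

Lemma chart_invK c y : chart_im c y -> chart_map c (chart_inv c y) = y.
Proof. by move=> [p cp <-]; rewrite chart_mapK. Qed.

Lemma chart_inv_dom c y : chart_im c y -> chart_dom c (chart_inv c y).
Proof. by move=> [p cp <-]; rewrite chart_mapK. Qed.

Lemma transition_smooth c d i j : atlas c -> atlas d ->
  smooth_on (chart_map c @` (chart_dom c `&` chart_dom d))
            (fun y => transition c d y i j).
Proof.
move=> ac ad; apply: (@smooth_on_coord _ _ _ _ _ (transition c d)).
  exact/chart_im_over_open/chart_dom_open.
exact: (atlas_compatible ac ad).
Qed.

Lemma smooth_curve_near (gam : R -> M) : smooth_curve gam -> forall c d,
  atlas c -> atlas d ->
  chart_dom c (gam 0) -> chart_dom d (gam 0) -> exists U : set R,
  [/\ open U, U 0, smooth_on U (chart_map c \o gam), smooth_on U (chart_map d \o gam) &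
  forall t, U t -> chart_dom c (gam t) /\ chart_dom d (gam t)].
Proof.
move=> [a [b [a0 b0 gc gs]]] c d ac ad c0 d0.
exists [set t | a < t < b /\ (chart_dom c `&` chart_dom d) (gam t)]; split.
- rewrite openE => t [/andP[ta tb] gt].
  have oc : open (chart_dom c `&` chart_dom d) by apply: openI; exact: chart_dom_open.
  have tab : a < t < b by rewrite ta tb.
  have tI : t \in `]a, b[ by rewrite in_itv.
  have nI : nbhs t [set u | a < u < b].
    by apply: filterS (near_in_itvoo tI) => u; rewrite in_itv.
  exact: filterI nI (gc t tab _ (open_nbhs_nbhs (conj oc gt))).
- by rewrite /= a0 b0.
- by apply: smooth_on_sub (gs c ac) => t [? []].
- by apply: smooth_on_sub (gs d ad) => t [? []].
- by move=> t [_ []].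
Qed.

Lemma curve_derive_transition (gam : R -> M) c d n s i :
  smooth_curve gam -> atlas c -> atlas d ->
  chart_dom c (gam 0) -> chart_dom d (gam 0) -> (s <= n)%N ->
  curve_derive d gam s 0 i =
  prol s (fun y => transition c d y 0 i) (curve_jet (n := n) (chart_map c \o gam) 0).
Proof.
move=> sg ac ad c0 d0 sn.
have [U [oU U0 sc sd Ucd]] := smooth_curve_near sg ac ad c0 d0.
have oO : open (chart_map c @` (chart_dom c `&` chart_dom d)).
  exact/chart_im_over_open/chart_dom_open.
rewrite /curve_derive -(derive1n_coord _ _ _ oU sd U0).
rewrite -(@prol_curve _ _ _ U _ _ _ _ _ oU oO sc (transition_smooth 0 i ac ad) _ sn U0).
  apply: derive1n_eq oU _ U0 => t /Ucd[ct _] /=.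
  by rewrite /transition chart_mapK.
by move=> t /Ucd[ct dt]; exists (gam t).
Qed.

(** The velocity in one chart is a linear image of the velocity in another one,
    by the first prolongation of the change of chart. *)
Lemma velocity0_transition (gam : R -> M) c d :
  smooth_curve gam -> atlas c -> atlas d ->
  chart_dom c (gam 0) -> chart_dom d (gam 0) ->
  curve_derive c gam 1 = 0 -> curve_derive d gam 1 = 0.
Proof.
move=> sg ac ad c0 d0 v0; apply/rowP => i.
rewrite (@curve_derive_transition _ c d 1)// [RHS]mxE.
rewrite prolS.
rewrite (@derive_prol_agree _ _ _ 0 _ _ _ 0) ?derive0// => r k.
rewrite leqn0 => /eqP r0; rewrite totalE ?r0// mxE [RHS]mxE inordK//.
by rewrite -/(curve_derive c gam 1) v0 mxE.
Qed.

End Charts.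

(** * Jets in coordinates *)

Section JetCharts.
Context {R : realType} {m n : nat} {M : manifold R m}.
Hypothesis n_gt0 : (0 < n)%N.
Local Notation TnM := (regular_jet M n).
Local Notation coords := 'M[R]_(n.+1, m).
Implicit Types (c d : chart R m M) (j k : TnM) (O : set M).

Lemma same_jet_refl (gam : R -> M) : same_jet n gam gam.
Proof. by split. Qed.

Lemma same_jet_sym (gam del : R -> M) : same_jet n gam del -> same_jet n del gam.
Proof. by move=> [g0 H]; split=> // c ac; rewrite -g0 => c0 r rn; rewrite H. Qed.

Lemma same_jet_trans (gam del eps : R -> M) :
  same_jet n gam del -> same_jet n del eps -> same_jet n gam eps.
Proof.
move=> [g0 H] [d0 K]; split; first by rewrite g0.
by move=> c ac c0 r rn; rewrite H// K// -g0.
Qed.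

Lemma jet_rep_smooth j : smooth_curve (jet_rep j).
Proof. by rewrite /jet_rep; case: cid => gam []. Qed.

Lemma jet_rep_regular j : regular_curve (jet_rep j).
Proof. by rewrite /jet_rep; case: cid => gam []. Qed.

Lemma jet_class_rep j : jet_class j = jet n (jet_rep j).
Proof. by rewrite /jet_rep; case: cid => gam []. Qed.

Lemma jet_inj j k : same_jet n (jet_rep j) (jet_rep k) -> j = k.
Proof.
move=> jk; have : jet_class j = jet_class k.
  rewrite !jet_class_rep; apply/seteqP; split=> del [sd H]; split=> //.
    exact: same_jet_trans (same_jet_sym jk) H.
  exact: same_jet_trans jk H.
case: j k {jk} => [A HA] [B HB] /= AB; move: HA HB; rewrite AB => HA HB.
by rewrite (Prop_irrelevance HA HB).
Qed.

Lemma exists_jet (gam : R -> M) : smooth_curve gam -> regular_curve gam ->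
  exists j, same_jet n gam (jet_rep j).
Proof.
move=> sg rg; have H : exists g, [/\ smooth_curve g, regular_curve g & jet n gam = jet n g].
  by exists gam.
set j := RegularJet H; exists j.
have Hj : jet_class j (jet_rep j).
  by rewrite {1}jet_class_rep; split; [exact: jet_rep_smooth|exact: same_jet_refl].
by case: Hj.
Qed.

Definition jet_im c : set coords :=
  [set Y | chart_im c (row ord0 Y) /\ row (inord 1) Y != 0].

Lemma row_jet_coord c j (r : 'I_n.+1) : row r (jet_coord c j) = curve_derive c (jet_rep j) r.
Proof. by apply/rowP => i; rewrite !mxE. Qed.

Lemma row0_jet_coord c j : row ord0 (jet_coord c j) = chart_map c (jet_rep j 0).
Proof. by rewrite row_jet_coord. Qed.

Lemma jet_im_coord c j : atlas c -> jet_over c j -> jet_im c (jet_coord c j).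
Proof.
move=> ac cj; split.
  by rewrite row0_jet_coord; exists (jet_rep j 0).
rewrite row_jet_coord inordK//; exact: jet_rep_regular.
Qed.

Definition jet_trans c d (Y : coords) : coords :=
  \matrix_(s, i) prol s (fun y => transition c d y 0 i) Y.

Lemma jet_coord_trans c d j : atlas c -> atlas d -> jet_over c j -> jet_over d j ->
  jet_coord d j = jet_trans c d (jet_coord c j).
Proof.
move=> ac ad cj dj; apply/matrixP => s i; rewrite !mxE.
rewrite (curve_derive_transition (n := n) _ (jet_rep_smooth j) ac ad)//.
by rewrite -ltnS.
Qed.

Lemma jet_coord_inj c j k : atlas c -> jet_over c j -> jet_over c k ->
  jet_coord c j = jet_coord c k -> j = k.
Proof.
move=> ac cj ck E; apply: jet_inj.
have E0 : jet_rep j 0 = jet_rep k 0.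
  by rewrite -(chart_mapK cj) -(chart_mapK ck) -!row0_jet_coord E.
split=> // d ad dj r rn; have dk : jet_over d k by rewrite /jet_over /= -E0.
have := row_jet_coord d j (inord r); rewrite inordK// => <-.
have := row_jet_coord d k (inord r); rewrite inordK// => <-.
by rewrite (jet_coord_trans ac ad cj dj) E -(jet_coord_trans ac ad ck dk).
Qed.

Lemma in_coordsE c (f : TnM -> R) j : atlas c -> jet_over c j ->
  in_coords c f (jet_coord c j) = f j.
Proof.
move=> ac cj; rewrite /in_coords; case: xgetP => [a -> [k [ck E <-]]|/(_ (f j))].
  by rewrite (jet_coord_inj ac ck cj E).
by case; exists j.
Qed.

(** A matrix in [jet_im c] is realized by reading the polynomial curve with these
    derivatives back through the chart. Its velocity is nonzero in [c], hence
    in every other chart. *)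
Lemma taylor_curve_regular c (Y : coords) : atlas c -> jet_im c Y ->
  exists gam : R -> M, [/\ smooth_curve gam, regular_curve gam, chart_dom c (gam 0) &
    forall r : 'I_n.+1, curve_derive c gam r = row r Y].
Proof.
move=> ac [Y0 Y1]; pose g := taylor_curve Y 0.
have sg : smooth_on setT g by apply: taylor_curve_smooth; exact: openT.
have cg t : {for t, continuous g}.
  by apply: differentiable_continuous; exact: smooth_on_diff sg _.
have g0 : chart_im c (g 0) by rewrite /g (taylor_curve0 Y ord0).
have : nbhs (0 : R) (g @^-1` chart_im c).
  by apply: cg; apply: open_nbhs_nbhs; split=> //; exact: chart_im_open.
move=> /nbhs_ballP[e /= e0 He].
have ge t : - e < t < e -> chart_im c (g t).
  by move=> te; apply: He; rewrite -ball_normE /= sub0r normrN ltr_norml.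
pose gam t := chart_inv c (g t).
have gc t : - e < t < e -> chart_map c (gam t) = g t.
  by move=> te; rewrite /gam chart_invK//; exact: ge.
have gamc t : - e < t < e -> {for t, continuous gam}.
  move=> te; apply: (@continuous_comp _ _ _ g (chart_inv c)); first exact: cg.
  exact/chart_inv_cts/ge.
have z0 : - e < 0 < e by rewrite oppr_lt0 e0.
have smg : smooth_curve gam.
  exists (- e), e; split=> //; [by rewrite oppr_lt0|].
  move=> d ad; set S := [set _ | _].
  have oS : open S.
    rewrite openE => t [te dt].
    have tI : t \in `](- e), e[ by rewrite in_itv.
    have nI : nbhs t [set u | - e < u < e].
      by apply: filterS (near_in_itvoo tI) => u; rewrite in_itv.
    exact: filterI nI (gamc t te _ (open_nbhs_nbhs (conj (chart_dom_open d) dt))).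
  apply: smooth_on_mx => // i k; apply: smooth_termP => //.
  apply: (@term_comp _ _ _ _ _ (chart_map c @` (chart_dom c `&` chart_dom d))
    (fun y => transition c d y i k) g).
  - exact: transition_smooth.
  - move=> t [te dt]; exists (gam t); last exact: gc.
    by split=> //; exact/chart_inv_dom/ge.
  - move=> a b; apply: term_smooth; apply: smooth_on_coord => //.
    exact: smooth_on_sub sg.
have c0 : chart_dom c (gam 0) by exact: chart_inv_dom.
have dg (r : 'I_n.+1) : curve_derive c gam r = row r Y.
  rewrite /curve_derive -taylor_curve0 -derive1n_taylor.
  have oI : open [set t | - e < t < e].
    rewrite openE => t te; have tI : t \in `](- e), e[ by rewrite in_itv.
    by apply: filterS (near_in_itvoo tI) => u; rewrite in_itv.
  exact: (derive1n_eq r oI gc z0).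
exists gam; split=> // d ad d0; apply/eqP => v0; move/eqP: Y1; apply.
rewrite -dg inordK//; exact: (velocity0_transition smg ad ac d0 c0 v0).
Qed.

Lemma exists_jet_coord c Y : atlas c -> jet_im c Y ->
  exists2 j, jet_over c j & jet_coord c j = Y.
Proof.
move=> ac iY; have [gam [sg rg c0 E]] := taylor_curve_regular ac iY.
have [j [g0 H]] := exists_jet sg rg.
exists j; first by rewrite /jet_over /= -g0.
apply/row_matrixP => r; rewrite row_jet_coord -H// -1?E//.
by rewrite -ltnS.
Qed.

Lemma jet_coord_im c : atlas c -> jet_coord c @` @jet_over _ _ M n c = jet_im c.
Proof.
move=> ac; apply/seteqP; split=> [_ [j cj <-]|Y /(exists_jet_coord ac)[j cj <-]].
  exact: jet_im_coord.
by exists j.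
Qed.

Definition jet_im_over c O : set coords :=
  [set Y | jet_im c Y /\ O (chart_inv c (row ord0 Y))].

Lemma jet_im_over_open c O : open O -> open (jet_im_over c O).
Proof.
move=> oO.
have -> : jet_im_over c O = over (chart_map c @` (chart_dom c `&` O)) `&`
    (fun Y : coords => row (inord 1) Y) @^-1` [set y | y != 0].
  rewrite chart_imE; apply/seteqP; split=> [Y [[? ?] ?]|Y [[? ?] ?]]; by split.
apply: openI; first exact/over_open/chart_im_over_open.
apply: open_comp => [Y _|]; first exact: (linear_mx_continuous (row_linear _)).
have -> : [set y : 'rV[R]_m | y != 0] = ~` [set 0].
  by apply/seteqP; split=> y /eqP.
apply: closed_openC.
exact/accessible_closed_set1/hausdorff_accessible/norm_hausdorff.
Qed.

Lemma jet_im_open c : open (jet_im c).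
Proof.
have -> : jet_im c = jet_im_over c setT.
  by apply/seteqP; split=> [Y|Y []].
exact/jet_im_over_open/openT.
Qed.

Lemma jet_im_overP c O j : atlas c -> jet_over c j ->
  jet_im_over c O (jet_coord c j) <-> O (jet_rep j 0).
Proof.
move=> ac cj; rewrite /jet_im_over /= row0_jet_coord chart_mapK//.
by split=> [[]|]//; split=> //; exact: jet_im_coord.
Qed.

End JetCharts.

(** * Smooth functions and vector fields on the jet manifold *)

Section JetFunctions.
Context {R : realType} {m n : nat} {M : manifold R m}.
Context (n_gt0 : (0 < n)%N).
Local Notation TnM := (regular_jet M n).
Local Notation coords := 'M[R]_(n.+1, m).
Implicit Types (c d : chart R m M) (j k : TnM) (O : set M) (f g : TnM -> R).
Local Notation jet_im := (@jet_im R m n M).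

Lemma smooth_funE f : smooth_fun f <->
  forall c, atlas c -> smooth_on (jet_im c) (in_coords c f).
Proof.
by split=> sf c ac; have := sf c ac; rewrite (jet_coord_im n_gt0 ac).
Qed.

Lemma smooth_fun_diff c f j : atlas c -> jet_over c j -> smooth_fun f ->
  differentiable (in_coords c f) (jet_coord c j).
Proof.
move=> ac cj /smooth_funE/(_ c ac) sf; apply: smooth_on_diff sf _.
exact: jet_im_coord.
Qed.

Lemma jet_trans_smooth c d i s : atlas c -> atlas d ->
  smooth_on (jet_im_over c (chart_dom d)) (fun Y : coords => jet_trans c d Y s i).
Proof.
move=> ac ad; set O := chart_map c @` (chart_dom c `&` chart_dom d).
have oO : open O by exact/chart_im_over_open/chart_dom_open.
apply: (@smooth_on_sub _ _ _ (over O)).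
  by move=> Y [[Y0 _] dY]; rewrite /over /O chart_imE.
have := @prol_smooth R n m s _ O oO (transition_smooth 0 i ac ad).
by apply: smooth_on_eq; [exact: over_open|move=> Y _; rewrite mxE].
Qed.

Lemma in_coords_trans c d f (Y : coords) : atlas c -> atlas d ->
  jet_im_over c (chart_dom d) Y ->
  jet_im d (jet_trans c d Y) /\ in_coords c f Y = in_coords d f (jet_trans c d Y).
Proof.
move=> ac ad [/(exists_jet_coord n_gt0 ac)[j cj <-]].
rewrite row0_jet_coord chart_mapK// => dj.
rewrite -jet_coord_trans//; split; first exact: jet_im_coord.
by rewrite !in_coordsE.
Qed.

Lemma jet_trans_diff c d (Y : coords) : atlas c -> atlas d ->
  jet_im_over c (chart_dom d) Y -> differentiable (@jet_trans _ _ n _ c d) Y.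
Proof.
move=> ac ad cY; apply/differentiable_mxP => i s.
exact: smooth_on_diff (jet_trans_smooth _ _ ac ad) cY.
Qed.

(** Changes of chart between jets are prolongations, hence smooth, so that
    smoothness near a jet may be tested in a single chart. *)
Lemma smooth_fun_local f :
  (forall j, exists c, exists O : set coords, [/\ atlas c, jet_over c j, open O,
    O (jet_coord c j) & smooth_on (jet_im c `&` O) (in_coords c f)]) -> smooth_fun f.
Proof.
move=> H; apply/smooth_funE => d ad vs Y /(exists_jet_coord n_gt0 ad)[j dj <-].
have [c [ O [ac cj oO Oj sf]]] := H j.
have oA := @jet_im_over_open R m n M d _ (chart_dom_open c).
set W := jet_im_over d (chart_dom c) `&` jet_trans d c @^-1` O.
have oW : open W.
  apply: (open_preimage oA _ oO) => Z dZ; apply: differentiable_continuous.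
  exact: jet_trans_diff.
have Wj : W (jet_coord d j).
  split; first exact/(jet_im_overP n_gt0).
  by rewrite /= -jet_coord_trans.
suff sW : smooth_on W (in_coords d f) by exact: sW.
apply: smooth_termP => //.
apply: (@term_eq _ _ _ (fun Z => in_coords c f (jet_trans d c Z))).
  by move=> Z [dZ _]; rewrite (in_coords_trans f ad ac dZ).2.
apply: term_comp sf _ _.
  move=> Z [dZ OZ]; split=> //; exact: (in_coords_trans f ad ac dZ).1.
move=> i s; apply: term_smooth.
by apply: smooth_on_sub (jet_trans_smooth s i ad ac) => Z [].
Qed.

Lemma in_coords_ext c f (F : coords -> R) : atlas c ->
  (forall j, jet_over c j -> f j = F (jet_coord c j)) ->
  forall Y, jet_im c Y -> in_coords c f Y = F Y.
Proof.
move=> ac fF Y /(exists_jet_coord n_gt0 ac)[j cj <-].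
by rewrite in_coordsE// fF.
Qed.

Lemma smooth_fun_chart c f (F : coords -> R) : atlas c ->
  (forall j, jet_over c j -> f j = F (jet_coord c j)) ->
  smooth_on (jet_im c) F -> smooth_on (jet_im c) (in_coords c f).
Proof.
move=> ac fF; apply: smooth_on_eq; first exact: jet_im_open.
by move=> Y cY; rewrite (in_coords_ext ac fF cY).
Qed.

Lemma smooth_fun_cst (a : R) : smooth_fun (fun _ : TnM => a).
Proof.
apply/smooth_funE => c ac; apply: (@smooth_fun_chart _ _ (cst a)) => //.
exact: smooth_on_cst.
Qed.

Lemma smooth_funD f g : smooth_fun f -> smooth_fun g -> smooth_fun (fun j => f j + g j).
Proof.
move=> /smooth_funE sf /smooth_funE sg; apply/smooth_funE => c ac.
apply: (@smooth_fun_chart _ _ (fun Y => in_coords c f Y + in_coords c g Y)) => //.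
  by move=> j cj; rewrite !in_coordsE.
apply: smooth_termP; first exact: jet_im_open.
by apply: term_add; apply: term_smooth; [exact: sf|exact: sg].
Qed.

Lemma smooth_funM f g : smooth_fun f -> smooth_fun g -> smooth_fun (fun j => f j * g j).
Proof.
move=> /smooth_funE sf /smooth_funE sg; apply/smooth_funE => c ac.
apply: (@smooth_fun_chart _ _ (fun Y => in_coords c f Y * in_coords c g Y)) => //.
  by move=> j cj; rewrite !in_coordsE.
apply: smooth_termP; first exact: jet_im_open.
by apply: term_mul; apply: term_smooth; [exact: sf|exact: sg].
Qed.

Lemma in_coords_near c f g O j : atlas c -> open O -> jet_over c j -> O (jet_rep j 0) ->
  (forall k, O (jet_rep k 0) -> f k = g k) ->
  \forall Y \near jet_coord c j, in_coords c f Y = in_coords c g Y.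
Proof.
move=> ac oO cj Oj fg.
apply: (open_near_eq (U := jet_im_over c O)); first exact: jet_im_over_open.
  exact/(jet_im_overP n_gt0).
move=> Y [/(exists_jet_coord n_gt0 ac)[k ck <-]].
by rewrite row0_jet_coord chart_mapK// => Ok; rewrite !in_coordsE// fg.
Qed.

Lemma chart_atP j : atlas (chart_at j) /\ jet_over (chart_at j) j.
Proof. by rewrite /chart_at; case: cid2. Qed.

Lemma smooth_fun_eq_local f :
  (forall j, exists O g, [/\ open O, O (jet_rep j 0), smooth_fun g &
    forall k, O (jet_rep k 0) -> f k = g k]) -> smooth_fun f.
Proof.
move=> H; apply: smooth_fun_local => j; have [ O [g [oO Oj sg fg]]] := H j.
have [ac cj] := chart_atP j; set c := chart_at j in ac cj.
exists c, (jet_im_over c O); split=> //; first exact: jet_im_over_open.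
  exact/(jet_im_overP n_gt0).
have sgc : smooth_on (jet_im c `&` jet_im_over c O) (in_coords c g).
  by apply: smooth_on_sub ((smooth_funE g).1 sg c ac) => Y [].
apply: smooth_on_eq sgc; first by apply: openI; [exact: jet_im_open|exact: jet_im_over_open].
move=> Y [/(exists_jet_coord n_gt0 ac)[k ck <-]] [_].
by rewrite row0_jet_coord chart_mapK// => Ok; rewrite !in_coordsE// fg.
Qed.

Lemma Delta_near r f g O j : open O -> O (jet_rep j 0) ->
  (forall k, O (jet_rep k 0) -> f k = g k) -> Delta r f j = Delta r g j.
Proof.
move=> oO Oj fg; have [ac cj] := chart_atP j.
by apply: near_eq_derive; exact: in_coords_near Oj fg.
Qed.

Lemma jet_trans_Delta c d r (Y : coords) : atlas c -> atlas d ->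
  jet_im_over c (chart_dom d) Y -> (0 < r)%N ->
  'D_(Delta_comp r Y) (jet_trans c d) Y = Delta_comp r (jet_trans c d Y).
Proof.
move=> ac ad cY r0; apply/matrixP => s i.
rewrite -(derive_coord _ _ _ (jet_trans_diff ac ad cY)) Delta_compE.
have -> : (fun Z : coords => jet_trans c d Z s i) =
    prol s (fun y => transition c d y 0 i).
  by apply/funext => Z; rewrite mxE.
set O := chart_map c @` (chart_dom c `&` chart_dom d).
have oO : open O by exact/chart_im_over_open/chart_dom_open.
have OY : over O Y by move: cY => [[Y0 _] dY]; rewrite /over /O chart_imE.
have sn : (s <= n)%N by rewrite -ltnS.
rewrite (prol_Delta oO (transition_smooth 0 i ac ad) OY sn r0).
case: ifP => // rs; rewrite mxE inordK// ltnS.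
by rewrite leq_subLR addnC leq_add// -ltnS.
Qed.

(** [Delta r] is defined with a chosen chart at each jet; by [jet_trans_Delta]
    any other chart of the atlas gives the same derivation. *)
Lemma Delta_components r c : (0 < r)%N -> atlas c ->
  has_components (@Delta R m M n r) c (Delta_comp r).
Proof.
move=> r0 ac f sf j cj; rewrite /Delta.
have [ad dj] := chart_atP j; set d := chart_at j in ad dj *.
have dY : jet_im_over d (chart_dom c) (jet_coord d j) by exact/(jet_im_overP n_gt0).
have oA := @jet_im_over_open R m n M d _ (chart_dom_open c).
have E : \forall Y \near jet_coord d j, in_coords d f Y =
    in_coords c f (jet_trans d c Y).
  apply: (open_near_eq oA dY) => Z dZ; exact: (in_coords_trans f ad ac dZ).2.
rewrite (near_eq_derive _ E) derive_comp; last 2 first.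
- exact: jet_trans_diff.
- rewrite -jet_coord_trans//; exact: smooth_fun_diff.
by rewrite jet_trans_Delta// -jet_coord_trans.
Qed.

Lemma components_vector_field (X : operator M n) :
  (forall c, atlas c -> exists2 V, smooth_on (jet_im c) V & has_components X c V) ->
  vector_field X.
Proof.
move=> H; split.
- move=> f sf; apply/smooth_funE => c ac; have [V sV XV] := H c ac.
  apply: (@smooth_fun_chart _ _ (fun Y => 'D_(V Y) (in_coords c f) Y) ac (XV f sf)).
  exact: (smooth_on_along (@jet_im_open R m n M c) ((smooth_funE f).1 sf c ac) sV).
- move=> a f g sf sg j; have [ac cj] := chart_atP j.
  have [V sV XV] := H _ ac; rewrite !XV//; last first.
    by apply: smooth_funD => //; apply: smooth_funM => //; exact: smooth_fun_cst.
  set c := chart_at j in ac cj V sV XV *; set Y := jet_coord c j.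
  have df := smooth_fun_diff ac cj sf; have dg := smooth_fun_diff ac cj sg.
  rewrite (@near_eq_derive _ _ _ _ ((a *: in_coords c f) + in_coords c g)).
    have da := diff_derivable (v := V Y) df; have db := diff_derivable (v := V Y) dg.
    have dz : derivable (a *: in_coords c f) Y (V Y) by exact: (@derivableZ _ _ _ (in_coords c f) a Y (V Y) da).
    by rewrite (deriveD dz db) (deriveZ _ da).
  apply: (open_near_eq (@jet_im_open R m n M c) (jet_im_coord n_gt0 ac cj)) => Z.
  move=> /(exists_jet_coord n_gt0 ac)[k ck <-].
  by rewrite -[RHS]/(a * in_coords c f _ + in_coords c g _) !in_coordsE.
- move=> f g sf sg j; have [ac cj] := chart_atP j.
  have [V sV XV] := H _ ac; rewrite !XV//; last exact: smooth_funM.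
  set c := chart_at j in ac cj V sV XV *; set Y := jet_coord c j.
  have df := smooth_fun_diff ac cj sf; have dg := smooth_fun_diff ac cj sg.
  rewrite (@near_eq_derive _ _ _ _ (in_coords c f * in_coords c g)).
    have da := diff_derivable (v := V Y) df; have db := diff_derivable (v := V Y) dg.
    rewrite (deriveM da db) addrC /Y !in_coordsE//; congr (_ + _); exact: mulrC.
  apply: (open_near_eq (@jet_im_open R m n M c) (jet_im_coord n_gt0 ac cj)) => Z.
  move=> /(exists_jet_coord n_gt0 ac)[k ck <-].
  by rewrite -[RHS]/(in_coords c f _ * in_coords c g _) !in_coordsE.
Qed.

Lemma Delta_vector_field r : (0 < r)%N -> vector_field (@Delta R m M n r).
Proof.
move=> r0; apply: components_vector_field => c ac; exists (Delta_comp r).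
  exact/smooth_on_linear/Delta_comp_linear.
exact: Delta_components.
Qed.

Lemma lie_bracket_components (X X' : operator M n) c (V V' : coords -> coords) j f :
  atlas c -> vector_field X -> vector_field X' ->
  has_components X c V -> has_components X' c V' -> jet_over c j -> smooth_fun f ->
  differentiable V (jet_coord c j) -> differentiable V' (jet_coord c j) ->
  lie_bracket X X' f j =
  'D_('D_(V (jet_coord c j)) V' (jet_coord c j) - 'D_(V' (jet_coord c j)) V (jet_coord c j))
    (in_coords c f) (jet_coord c j).
Proof.
move=> ac [sX _ _] [sX' _ _] XV XV' cj sf dV dV'.
rewrite /lie_bracket XV ?XV'//; [|exact: sX|exact: sX'].
have iY := jet_im_coord n_gt0 ac cj; have oI := @jet_im_open R m n M c.
rewrite -(derive_commutator oI ((smooth_funE f).1 sf c ac) iY dV dV').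
congr (_ - _); apply: near_eq_derive; apply: (open_near_eq oI iY) => Y cY.
  exact: (@in_coords_ext _ _ (fun Y => 'D_(V' Y) (in_coords c f) Y) ac (XV' f sf) _ cY).
exact: (@in_coords_ext _ _ (fun Y => 'D_(V Y) (in_coords c f) Y) ac (XV f sf) _ cY).
Qed.

End JetFunctions.

(** * Bump functions *)

Section FlatFunction.
Context {R : realType}.
Implicit Types p : {poly R}.

(** The polynomial factor makes this family, [flat 1] being the standard flat
    function, stable under derivation. *)
Definition flat p (x : R) : R := if 0 < x then p.[x^-1] * expR (- x^-1) else 0.

Lemma expX_le k (y : R) : 0 <= y -> y ^+ k * expR (- y) <= k`!%:R.
Proof.
move=> y0; rewrite expRN ler_pdivrMr ?expR_gt0//.
case: k => [|k]; first by rewrite expr0 mul1r -expR0 ler_expR.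
rewrite mulrC -ler_pdivrMr ?ltr0n ?fact_gt0//.
by apply: le_trans (expR_ge1Dxn k y0); rewrite lerDr.
Qed.

(** Each monomial is bounded because [y ^+ i * expR (- y) <= i`!]. *)
Lemma flat_bounded p : exists2 C : R, 0 < C & forall x, `|flat p x| <= C.
Proof.
exists (\sum_(i < size p) `|p`_i| * i`!%:R + 1).
  by rewrite ltr_wpDl// sumr_ge0// => i _; rewrite mulr_ge0.
move=> x; rewrite /flat; case: ifPn => x0; last first.
  by rewrite normr0 addr_ge0// sumr_ge0// => i _; rewrite mulr_ge0.
apply: ler_wpDr => //; rewrite horner_coef mulr_suml.
rewrite (le_trans (ler_norm_sum _ _ _))//; apply: ler_sum => i _.
rewrite -mulrA normrM ler_wpM2l// ger0_norm; first by rewrite expX_le// invr_ge0 ltW.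
by rewrite mulr_ge0 ?expR_ge0// exprn_ge0// invr_ge0 ltW.
Qed.

Lemma flat_mulX2 p x : flat p x = x ^+ 2 * flat ('X^2 * p) x.
Proof.
rewrite /flat; case: ifPn => x0; last by rewrite mulr0.
have xn0 : x != 0 by rewrite gt_eqF.
rewrite hornerM hornerXn; move: p.[_] (expR _) => a e.
by field.
Qed.

Definition flat_diff p : {poly R} := 'X^2 * (p - p^`()).

(** By [flat_mulX2] the function is [x ^+ 2] times a bounded one near [0]. *)
Lemma flat_derive0 p : is_derive (0 : R) (1 : R) (flat p) 0.
Proof.
have [C C0 HC] := flat_bounded ('X^2 * p).
have f0 : flat p 0 = 0 by rewrite /flat ltxx.
have H : h^-1 *: ((flat p \o shift 0) (h *: (1 : R)) - flat p 0) @[h --> 0^'] --> (0 : R).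
  apply/cvgrPdist_le => e e0; near=> h.
  rewrite sub0r normrN f0 subr0 /= addr0 -[h *: 1]/(h * 1) mulr1 flat_mulX2.
  rewrite -[_ *: _]/(_ * _) expr2 !mulrA; have h0 : h != 0 by near: h; exact: nbhs_dnbhs_neq.
  rewrite mulVf// mul1r normrM.
  have hC : `|h| <= e / C by near: h; apply: dnbhs0_le; exact: divr_gt0.
  by rewrite (le_trans (ler_pM _ _ hC (HC h)))// divfK// gt_eqF.
by apply: DeriveDef; [apply/cvg_ex; exists 0|exact: cvg_lim H].
Unshelve. all: by end_near. Qed.

Lemma flat_derive p x : is_derive x (1 : R) (flat p) (flat (flat_diff p) x).
Proof.
have [x0|x0|->] := ltgtP x 0; last 1 first.
- have -> : flat (flat_diff p) 0 = 0 by rewrite /flat ltxx.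
  exact: flat_derive0.
- have -> : flat (flat_diff p) x = 0 by rewrite /flat ltNge ltW.
  apply: near_eq_is_derive (is_derive_cst (0 : R) x (1 : R)).
  near=> y; rewrite /flat ltNge ltW//=; near: y; exact: lt_nbhsl.
have xn0 : x != 0 by rewrite gt_eqF.
apply: (@near_eq_is_derive R R R (fun x => p.[x^-1] * expR (- x^-1))).
  near=> y; have y0 : 0 < y by near: y; exact: lt_nbhsr.
  by rewrite /flat y0.
have dV : is_derive x (1 : R) (fun y => y^-1) (- x ^- 2).
  apply: (is_derive_eq (is_deriveV xn0 (is_derive_id x (1 : R)))).
  by rewrite -[_ *: _]/(_ * _) mulr1.
have dN : is_derive x (1 : R) (fun y => - y^-1) (x ^- 2).
  by apply: (is_derive_eq (is_deriveN dV)); rewrite opprK.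
have dp : is_derive x (1 : R) (fun y => p.[y^-1]) (p^`().[x^-1] * - x ^- 2).
  exact: (is_derive1_comp (f := horner p) (g := fun y => y^-1)).
have de : is_derive x (1 : R) (fun y => expR (- y^-1)) (expR (- x^-1) * x ^- 2).
  exact: (is_derive1_comp (f := expR) (g := fun y => - y^-1)).
apply: (is_derive_eq (is_deriveM dp de)).
rewrite /flat x0 /flat_diff hornerM hornerXn hornerD hornerN -![_ *: _]/(_ * _).
by move: p.[_] p^`().[_] (expR _) => b a e; field.
Unshelve. all: by end_near. Qed.

Lemma flat_smooth p U : open U -> smooth_on U (flat p).
Proof.
move=> oU; have E k : derive1n k (flat p) = flat (iter k flat_diff p).
  elim: k => // k IH; rewrite derive1nS IH; apply/funext => x.
  by rewrite derive1E; have [_ ->] := flat_derive (iter k flat_diff p) x.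
apply: smooth_on_R => // k x _; rewrite E; apply/derivable1_diffP.
by have [] := flat_derive (iter k flat_diff p) x.
Qed.

Lemma flat1_gt0 x : 0 < x -> 0 < flat 1 x.
Proof. by move=> x0; rewrite /flat x0 hornerC mul1r expR_gt0. Qed.

Lemma flat1_ge0 x : 0 <= flat 1 x.
Proof. by rewrite /flat; case: ifP => // x0; rewrite hornerC mul1r expR_ge0. Qed.

Lemma flat1_eq0 x : x <= 0 -> flat 1 x = 0.
Proof. by move=> x0; rewrite /flat ltNge x0. Qed.

End FlatFunction.

Section Bump.
Context {R : realType} {m : nat}.
Implicit Types y : 'rV[R]_m.

Definition sqdist (y0 : 'rV[R]_m) (r : R) y : R := \sum_i ((y 0 i - y0 0 i) / r) ^+ 2.

(** A smooth step in the squared distance to [y0], measured in units of [r]: it is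
    [1] below [1/2] and [0] above [1]; one of the two terms of the denominator is always positive. *)
Definition bump (y0 : 'rV[R]_m) (r : R) y : R :=
  flat 1 (1 - sqdist y0 r y) /
  (flat 1 (1 - sqdist y0 r y) + flat 1 (sqdist y0 r y - 2^-1)).

Lemma term_sqdist y0 r U : smooth_term U (sqdist y0 r).
Proof.
have H i : smooth_term U (fun y => (y 0 i - y0 0 i) / r).
  apply: term_mul (term_cst _ _); apply: term_add (term_cst _ _).
  exact/term_smooth/smooth_on_entry.
by apply: term_sum => i; exact: term_mul (H i) (H i).
Qed.

Lemma bump_smooth y0 r U : open U -> smooth_on U (bump y0 r).
Proof.
move=> oU; apply: smooth_termP => //.
have sf : smooth_on setT (@flat R 1) by apply: flat_smooth; exact: openT.
have su := term_sqdist y0 r U.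
have s1 : smooth_term U (fun y => flat 1 (1 - sqdist y0 r y)).
  apply: (term_comp1 sf) => //; apply: term_eq (term_add (term_cst _ 1)
    (term_mul (term_cst _ (-1)) su)) => y _; by rewrite mulN1r.
have s2 : smooth_term U (fun y => flat 1 (sqdist y0 r y - 2^-1)).
  by apply: (term_comp1 sf) => //; exact: term_add su (term_cst _ _).
apply: (term_mul s1); apply: (term_inv (term_add s1 s2)) => y _.
rewrite gt_eqF//; have [u1|u1] := ltP (sqdist y0 r y) 1.
  by rewrite ltr_pwDl ?flat1_ge0// flat1_gt0// subr_gt0.
rewrite ltr_wpDl ?flat1_ge0// flat1_gt0// subr_gt0 (lt_le_trans _ u1)//.
by rewrite invf_lt1// ltr1n.
Qed.

Lemma bump_near1 y0 r : \forall y \near y0, bump y0 r y = 1.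
Proof.
have d : differentiable (sqdist y0 r) y0.
  have := smooth_termP openT (term_sqdist y0 r setT).
  by move=> s; exact: smooth_on_diff s _.
have u0 : sqdist y0 r y0 = 0.
  by rewrite /sqdist big1// => i _; rewrite subrr mul0r expr0n.
have h0 : 0 < (2^-1 : R) by rewrite invr_gt0.
have : \forall y \near y0, sqdist y0 r y < 2^-1.
  have c := differentiable_continuous d.
  have h1 : sqdist y0 r y0 < 2^-1 by rewrite u0.
  exact: (c _ (lt_nbhsl h1)).
apply: filterS => y uy; rewrite /bump [X in _ / (_ + X)]flat1_eq0; last by rewrite subr_le0 ltW.
rewrite addr0 divff// gt_eqF// flat1_gt0// subr_gt0 (lt_trans uy)//.
by rewrite invf_lt1// ltr1n.
Qed.

Lemma bump_support y0 r y : 0 < r -> bump y0 r y != 0 -> `|y0 - y| <= r.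
Proof.
move=> r0 by0; have u1 : sqdist y0 r y < 1.
  rewrite ltNge; apply: contra by0 => u1; rewrite /bump flat1_eq0 ?mul0r//.
  by rewrite subr_le0.
rewrite /Num.Def.normr/= mx_normrE (bigmax_le _ (ltW r0))//= => -[i k] _ /=.
rewrite !mxE ord1 distrC -[leRHS]mul1r -ler_pdivrMr// -[X in _ / X](gtr0_norm r0) -normf_div.
rewrite -(@ler_pXn2r _ 2) ?nnegrE// expr1n real_normK ?num_real// (le_trans _ (ltW u1))//.
rewrite /sqdist (bigD1 k)//= lerDl sumr_ge0// => l _; exact: sqr_ge0.
Qed.

End Bump.

(** * Cut-off functions on the manifold and on the jets *)

Section Cutoff.
Context {R : realType} {m : nat} {M : manifold R m}.
Implicit Types (c d : chart R m M) (O : set M).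

(** The support is asked to be closed in [M], not only in the domain of the
    chart: this is what makes extensions by zero smooth. *)
Definition cutoff c (b : M -> R) : Prop :=
  smooth_on (chart_im c) (fun y => b (chart_inv c y)) /\
  exists K : set M, [/\ closed K, K `<=` chart_dom c & forall q, ~ K q -> b q = 0].

(** A small closed ball of the chart is compact, so its image in [M] is compact,
    hence closed since [M] is Hausdorff. *)
Lemma exists_cutoff c p : chart_dom c p -> exists b O,
  [/\ cutoff c b, open O, O p & forall q, O q -> b q = 1].
Proof.
move=> cp; set y0 := chart_map c p.
have : nbhs y0 (chart_im c) by apply: open_nbhs_nbhs; split; [exact: chart_im_open|exists p].
move=> /nbhs_ballP[r0 /= r00 Hr]; pose r := r0 / 2.
have rpos : 0 < r by rewrite divr_gt0.
pose K0 := closed_ball y0 r.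
have K0E y : K0 y <-> `|y0 - y| <= r by rewrite /K0 closed_ballE.
have K0c : K0 `<=` chart_im c.
  move=> y /K0E yr; apply: Hr; rewrite -ball_normE /= (le_lt_trans yr)//.
  by rewrite /r ltr_pdivrMr// mulr2n mulrDr mulr1 ltrDl.
have cK0 : compact K0.
  apply: bounded_closed_compact; last exact: closed_ball_closed.
  exists (`|y0| + r); split; first exact: num_real.
  move=> x xr y /K0E yr /=; rewrite (le_trans _ (ltW xr))//.
  by rewrite -(subrK y0 y) addrC (le_trans (ler_normD _ _))// lerD2l distrC.
have cK : compact (chart_inv c @` K0).
  apply: continuous_compact cK0; apply: continuous_in_subspaceT => y.
  by rewrite inE => /K0c; exact: chart_inv_cts.
pose b (q : M) : R := if `[< chart_dom c q >] then bump y0 r (chart_map c q) else 0.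
have [W [oW Wy0] Wb] : exists2 W : set 'rV[R]_m, open W /\ W y0 &
    forall y, W y -> bump y0 r y = 1.
  have nb : nbhs y0 [set y | bump y0 r y = 1] by exact: bump_near1.
  rewrite nbhsE in nb; have [W [oW Wy] Hb] := nb.
  by exists W.
exists b, (chart_dom c `&` chart_map c @^-1` W); split.
- split.
    apply: smooth_on_eq (bump_smooth y0 r (@chart_im_open _ _ _ c)).
      exact: chart_im_open.
    by move=> y cy; rewrite /b chart_invK// asboolT//; exact: chart_inv_dom.
  exists (chart_inv c @` K0); split.
  + by apply: compact_closed cK; exact: manifold_hausdorff.
  + by move=> _ [y /K0c cy <-]; exact: chart_inv_dom.
  + move=> q Kq; rewrite /b; case: asboolP => // cq; apply/eqP/negPn/negP => bq.
    apply: Kq; exists (chart_map c q); last exact: chart_mapK.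
    exact/K0E/bump_support.
- apply: open_preimage => //; first exact: chart_dom_open.
  by move=> q cq; exact: chart_map_cts.
- by split.
- by move=> q [cq Wq]; rewrite /b asboolT//; exact: Wb.
Qed.

End Cutoff.

Section JetCutoff.
Context {R : realType} {m n : nat} {M : manifold R m}.
Context (n_gt0 : (0 < n)%N).
Local Notation TnM := (regular_jet M n).
Local Notation coords := 'M[R]_(n.+1, m).
Implicit Types (c d : chart R m M) (j k : TnM) (O : set M) (h : coords -> R).
Local Notation jet_im := (@jet_im R m n M).

Definition cut c (b : M -> R) h (j : TnM) : R :=
  if `[< jet_over c j >] then b (jet_rep j 0) * h (jet_coord c j) else 0.

Lemma cut_over c b h j : jet_over c j -> cut c b h j = b (jet_rep j 0) * h (jet_coord c j).
Proof. by move=> cj; rewrite /cut asboolT. Qed.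

Lemma cut_off c b h j : cutoff c b -> ~ jet_over c j -> exists O,
  [/\ open O, O (jet_rep j 0), b (jet_rep j 0) = 0 &
      forall k, O (jet_rep k 0) -> cut c b h k = 0].
Proof.
move=> [_ [K [cK Kc bK]]] cj; exists (~` K).
have Kj : (~` K) (jet_rep j 0) by move=> /Kc.
split=> //; [exact: closed_openC|exact: bK|].
by move=> k Kk; rewrite /cut bK// mul0r; case: asboolP.
Qed.

Definition base_fun c (b : M -> R) (Y : coords) : R := b (chart_inv c (row ord0 Y)).

Lemma base_fun_smooth c b : cutoff c b -> smooth_on (jet_im c) (base_fun c b).
Proof.
move=> [sb _]; apply: smooth_termP; first exact: jet_im_open.
apply: (@term_comp _ _ _ _ _ _ (fun y => b (chart_inv c y)) (fun Y : coords => row ord0 Y) sb).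
  by move=> Y [].
move=> i k; apply: term_smooth; apply: smooth_on_coord; first exact: jet_im_open.
exact: smooth_on_linear (row_linear ord0).
Qed.

(** For [r > 0] the field [Delta^r] does not move the base point, so functions
    lifted from [M] are invariant. This allows solutions of linear equations
    in the [Delta^r] to be glued with cut-off functions of [M]. *)
Lemma derive_base_fun c b r (Y : coords) : (0 < r)%N ->
  'D_(Delta_comp r Y) (base_fun c b) Y = 0.
Proof.
move=> r0; rewrite (@eq_derive_dir _ _ _ _ (base_fun c b) _ Y _ 0) ?derive0// => t.
rewrite scaler0 add0r /base_fun; congr (b (chart_inv c _)).
apply/rowP => i; rewrite mxE [RHS]mxE mxE [X in X + _]mxE Delta_compE.
by rewrite leqNgt r0 mulr0 add0r.
Qed.

Lemma cut_coords c b h (Y : coords) : atlas c -> jet_im c Y ->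
  in_coords c (cut c b h) Y = base_fun c b Y * h Y.
Proof.
move=> ac; apply: (@in_coords_ext _ _ _ _ n_gt0 _ _ (fun Y => base_fun c b Y * h Y) ac).
move=> j cj; rewrite cut_over// /base_fun row0_jet_coord chart_mapK//.
Qed.

Lemma cut_smooth c b h : atlas c -> cutoff c b -> smooth_on (jet_im c) h ->
  smooth_fun (cut c b h).
Proof.
move=> ac cb sh; apply: (smooth_fun_local n_gt0) => j.
have [cj|cj] := pselect (jet_over c j).
  exists c, setT; split=> //; first exact: openT.
  rewrite setIT; apply: smooth_on_eq (_ : smooth_on _ (fun Y => base_fun c b Y * h Y)).
  - exact: jet_im_open.
  - by move=> Y cY; rewrite cut_coords.
  - apply: smooth_termP; first exact: jet_im_open.
    by apply: term_mul; apply: term_smooth => //; exact: base_fun_smooth.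
have [ O [oO Oj _ H]] := cut_off h cb cj.
have [ad dj] := chart_atP j; set d := chart_at j in ad dj.
exists d, (jet_im_over d O); split=> //; first exact: jet_im_over_open.
  exact/(jet_im_overP n_gt0).
apply: smooth_on_eq (@smooth_on_cst _ _ _ _ (0 : R)).
  by apply: openI; [exact: jet_im_open|exact: jet_im_over_open].
move=> Y [/(exists_jet_coord n_gt0 ad)[k dk <-]] [_].
by rewrite row0_jet_coord chart_mapK// => Ok; rewrite in_coordsE// H.
Qed.

Lemma Delta_cst r (a : R) j : Delta r (fun=> a) j = 0.
Proof.
have [ac cj] := chart_atP j; rewrite /Delta.
rewrite (@near_eq_derive _ _ _ _ (cst a)) ?derive_cst//.
apply: (open_near_eq (@jet_im_open R m n M (chart_at j)) (jet_im_coord n_gt0 ac cj)).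
by move=> Y; exact: (@in_coords_ext _ _ _ _ n_gt0 _ _ (cst a)).
Qed.

Lemma Delta_cut r c b h j : (0 < r)%N -> atlas c -> cutoff c b ->
  smooth_on (jet_im c) h -> jet_over c j ->
  Delta r (cut c b h) j =
  b (jet_rep j 0) * 'D_(Delta_comp r (jet_coord c j)) h (jet_coord c j).
Proof.
move=> r0 ac cb sh cj; rewrite (Delta_components n_gt0 r0 ac (cut_smooth ac cb sh) cj).
have iY := jet_im_coord n_gt0 ac cj; set Y := jet_coord c j in iY *.
have dB := smooth_on_diff (base_fun_smooth cb) iY; have dh := smooth_on_diff sh iY.
rewrite (@near_eq_derive _ _ _ _ (base_fun c b * h)); last first.
  by apply: (open_near_eq (@jet_im_open R m n M c) iY) => Z cZ; rewrite cut_coords.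
have D := @deriveM _ _ _ _ _ (Delta_comp r Y) (diff_derivable dB) (diff_derivable dh).
rewrite D derive_base_fun// scaler0 addr0 -[_ *: _]/(_ * _); congr (_ * _).
by rewrite /base_fun /Y row0_jet_coord chart_mapK.
Qed.

Lemma Delta_cut_off r c b h j : cutoff c b -> ~ jet_over c j ->
  Delta r (cut c b h) j = 0 /\ b (jet_rep j 0) = 0.
Proof.
move=> cb cj; have [ O [oO Oj b0 H]] := cut_off h cb cj; split=> //.
by rewrite (Delta_near n_gt0 r oO Oj (H : forall k, _ -> _ = (fun=> 0) k)) Delta_cst.
Qed.

(** The coordinate functions, cut off, are global smooth functions that separate
    tangent vectors. Identities between derivations of global functions thus
    become identities between components. *)
Lemma tangent_eq c j (A B : coords) : atlas c -> jet_over c j ->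
  (forall f, smooth_fun f -> 'D_A (in_coords c f) (jet_coord c j) =
                             'D_B (in_coords c f) (jet_coord c j)) -> A = B.
Proof.
move=> ac cj H; have [b [ O [cb oO Oj b1]]] := exists_cutoff cj.
apply/matrixP => s i; pose h (Y : coords) := Y s i.
have sh : smooth_on (jet_im c) h by exact: smooth_on_entry.
have E : \forall Y \near jet_coord c j, in_coords c (cut c b h) Y = h Y.
  apply: (open_near_eq (U := jet_im_over c O)); first exact: jet_im_over_open.
    exact/(jet_im_overP n_gt0).
  by move=> Y [cY OY]; rewrite cut_coords// /base_fun b1// mul1r.
have := H _ (cut_smooth ac cb sh).
by rewrite !(near_eq_derive _ E) !derive_entry.
Qed.

End JetCutoff.

(** * Normalization of a differential equation field in a chart *)

Section DerivationRules.
Context {R : realType} {V : normedModType R}.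
Implicit Types (f g : V -> R) (x v : V).

Lemma is_derive_mul f g x v a b : is_derive x v f a -> is_derive x v g b ->
  is_derive x v (fun y => f y * g y) (a * g x + f x * b).
Proof.
move=> df dg; apply: (is_derive_eq (is_deriveM df dg)).
by rewrite -![_ *: _]/(_ * _) addrC mulrC.
Qed.

Lemma is_derive_add f g x v a b : is_derive x v f a -> is_derive x v g b ->
  is_derive x v (fun y => f y + g y) (a + b).
Proof. by move=> df dg; exact: is_deriveD. Qed.

Lemma is_derive_opp f x v a : is_derive x v f a -> is_derive x v (fun y => - f y) (- a).
Proof. by move=> df; exact: is_deriveN. Qed.

Lemma is_derive_scale f x v a k : is_derive x v f a ->
  is_derive x v (fun y => k * f y) (k * a).
Proof.
move=> df; apply: (is_derive_eq (is_derive_mul (is_derive_cst k x v) df)).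
by rewrite mul0r add0r.
Qed.

Lemma is_derive_pow f x v a k : is_derive x v f a ->
  is_derive x v (fun y => f y ^+ k.+1) (k.+1%:R * f x ^+ k * a).
Proof.
move=> df; elim: k => [|k IH].
  by rewrite expr0 !mul1r.
under eq_fun do rewrite exprS.
apply: (is_derive_eq (is_derive_mul df IH)).
rewrite -(natr1 k.+1) exprS.
by move: (k.+1%:R) (f x ^+ k) => e u; ring.
Qed.

Lemma is_derive_div f g x v a b : g x != 0 ->
  is_derive x v f a -> is_derive x v g b ->
  is_derive x v (fun y => f y / g y) ((a - f x / g x * b) / g x).
Proof.
move=> g0 df dg.
have dV : is_derive x v (fun y => (g y)^-1) (- (g x) ^- 2 * b).
  by apply: DeriveDef; [apply: derivableV => //; case: dg|rewrite deriveV//; case: dg => _ -> ].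
apply: (is_derive_eq (is_derive_mul df dV)).
by move: (f x) (g x) g0 => u w w0; field.
Qed.

Lemma is_derive_sumf N (F : 'I_N -> V -> R) x v (a : 'I_N -> R) :
  (forall i, is_derive x v (F i) (a i)) ->
  is_derive x v (fun y => \sum_i F i y) (\sum_i a i).
Proof.
move=> dF; have -> : (fun y => \sum_i F i y) = \sum_i F i.
  by apply/funext => y; rewrite fct_sumE.
exact: is_derive_sum.
Qed.

End DerivationRules.

Section LocalSolution.
Context {R : realType} {n m : nat}.
Local Notation coords := 'M[R]_(n.+1, m).
Implicit Types (Y v : coords).

Definition inner (r s : nat) Y : R := \sum_i Y (inord r) i * Y (inord s) i.

Lemma is_derive_entry Y v r i : is_derive Y v (fun Z : coords => Z r i : R) (v r i).
Proof.
apply: DeriveDef; last exact: derive_entry.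
exact/diff_derivable/differentiable_coord.
Qed.

Lemma Delta1_entry (r : nat) Y i : (r <= n)%N ->
  Delta_comp 1 Y (inord r) i = r%:R * Y (inord r) i.
Proof.
move=> rn; rewrite Delta_compE inordK// addn1 subSS subn0.
case: r rn => [|r] rn; first by rewrite mul0r.
rewrite /= subSS subn0 factS natrM.
by rewrite mulfK// factR_neq0.
Qed.

Lemma Delta2_entry (r : nat) Y i : (r <= n)%N ->
  Delta_comp 2 Y (inord r) i = (r * r.-1)%:R * Y (inord r.-1) i.
Proof.
move=> rn; rewrite Delta_compE inordK// addn1 subSS.
case: r rn => [|[|r]] rn; rewrite ?muln0 ?mul0n ?mul0r//=.
rewrite !subSS !subn0 !factS !natrM !mulrA.
by rewrite mulfK// factR_neq0.
Qed.

Lemma is_derive_inner r s Y v : is_derive Y v (inner r s)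
  (\sum_i (v (inord r) i * Y (inord s) i + Y (inord r) i * v (inord s) i)).
Proof.
by apply: is_derive_sumf => i; apply: is_derive_mul; exact: is_derive_entry.
Qed.

Lemma inner_Delta1 r s Y : (r <= n)%N -> (s <= n)%N ->
  is_derive Y (Delta_comp 1 Y) (inner r s) ((r + s)%:R * inner r s Y).
Proof.
move=> rn sn; apply: (is_derive_eq (is_derive_inner r s Y _)).
rewrite /inner mulr_sumr; apply: eq_bigr => i _; rewrite !Delta1_entry// natrD.
by ring.
Qed.

Lemma inner_Delta2 s Y : (0 < n)%N -> (s <= n)%N ->
  is_derive Y (Delta_comp 2 Y) (inner 1 s) ((s * s.-1)%:R * inner 1 s.-1 Y).
Proof.
move=> n0 sn; apply: (is_derive_eq (is_derive_inner 1 s Y _)).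
rewrite /inner mulr_sumr; apply: eq_bigr => i _; rewrite !Delta2_entry//.
by rewrite muln0 !mul0r add0r mulrCA.
Qed.

Lemma inner11_neq0 Y : row (inord 1) Y != 0 -> inner 1 1 Y != 0.
Proof.
apply: contra => /eqP H; apply/eqP/rowP => i; rewrite !mxE.
have : Y (inord 1) i * Y (inord 1) i = 0.
  by apply: (psumr_eq0P _ H) => // k _; rewrite -expr2 sqr_ge0.
by move=> /eqP; rewrite mulf_eq0 orbb => /eqP.
Qed.

Hypothesis n_ge2 : (2 <= n)%N.
Let n_gt0 : (0 < n)%N := ltnW n_ge2.

(** A function with [Delta^1 slope = slope] and [Delta^2 slope = 2], hence a
    coordinate along the orbits of [Delta^2]. *)
Definition slope Y : R := inner 1 2 Y / inner 1 1 Y.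

Fixpoint straight_coef (k : nat) : R :=
  if k is k'.+1 then
    - straight_coef k' * ((n - k') * (n - k').-1)%:R / (2 * k.+1%:R)
  else (n * n.+1)%:R / 2.

(** If [Gam] satisfies the two bracket relations, its last component [G]
    satisfies [Delta^1 G = (n+1) G] and [Delta^2 G = n(n+1) y_n], so [<y_1, G>]
    satisfies [Delta^1 h = (n+2) h] and [Delta^2 h = n(n+1) <y_1, y_n>]. This
    polynomial in [slope] and the [<y_1, y_s>] solves the same two equations
    without reference to [G]: each term has weight [n + 2], and the recursion
    for the coefficients makes its derivative along [Delta^2] telescope. *)
Definition straight Y : R :=
  \sum_(k < n) straight_coef k * slope Y ^+ k.+1 * inner 1 (n - k) Y.

Lemma slope_Delta1 Y : inner 1 1 Y != 0 ->
  is_derive Y (Delta_comp 1 Y) slope (slope Y).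
Proof.
move=> q0; apply: (is_derive_eq (is_derive_div q0
  (inner_Delta1 Y n_gt0 n_ge2) (inner_Delta1 Y n_gt0 n_gt0))).
by rewrite /slope; move: (inner 1 1 Y) q0 (inner 1 2 Y) => q q0 u; field.
Qed.

Lemma slope_Delta2 Y : inner 1 1 Y != 0 -> is_derive Y (Delta_comp 2 Y) slope 2.
Proof.
move=> q0; apply: (is_derive_eq (is_derive_div q0
  (inner_Delta2 Y n_gt0 n_ge2) (inner_Delta2 Y n_gt0 n_gt0))).
by rewrite /= muln0 mul0r mulr0 subr0 muln1 mulfK.
Qed.

Lemma straight_Delta1 Y : inner 1 1 Y != 0 ->
  is_derive Y (Delta_comp 1 Y) straight ((n + 2)%:R * straight Y).
Proof.
move=> q0; rewrite /straight mulr_sumr; apply: is_derive_sumf => k.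
have kn : (n - k <= n)%N by exact: leq_subr.
apply: (is_derive_eq (is_derive_mul (is_derive_scale (straight_coef k)
  (is_derive_pow k (slope_Delta1 q0))) (inner_Delta1 Y n_gt0 kn))).
have -> : (n + 2 = k.+1 + (1 + (n - k)))%N.
  by rewrite -{1}(subnKC (ltnW (ltn_ord k))) addn2 add1n addSn addnS.
rewrite [in RHS]natrD exprS.
move: (k.+1%:R) ((1 + (n - k))%:R) (straight_coef k) (slope Y) => e1 e2 a u.
by move: (u ^+ k) (inner _ _ _) => w z; ring.
Qed.

Lemma straight_Delta2 Y : inner 1 1 Y != 0 ->
  is_derive Y (Delta_comp 2 Y) straight ((n * n.+1)%:R * inner 1 n Y).
Proof.
move=> q0; pose A k := 2 * k.+1%:R * straight_coef k * slope Y ^+ k * inner 1 (n - k) Y.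
have -> : (n * n.+1)%:R * inner 1 n Y = \sum_(k < n) (A k - A k.+1).
  rewrite -(big_mkord xpredT (fun k => A k - A k.+1)).
  rewrite -[LHS]opprK -[RHS]opprK -sumrN; congr (- _).
  under [RHS]eq_bigr do rewrite opprB.
  rewrite telescope_sumr// /A subn0 /= expr0.
  (* The boundary term vanishes: the recursion has the factor (n - k).-1, which
     is 0 at k = n - 1. *)
  have -> : straight_coef n = 0.
    have -> : n = n.-1.+1 by rewrite prednK.
    have E : (n - n.-1 = 1)%N by rewrite -subn1 subKn.
    by rewrite /= E muln0 mulr0 mul0r.
  rewrite mulr0 !mul0r sub0r; congr (- _).
  by move: ((n * n.+1)%:R) (inner _ _ _) => a b; field.
apply: is_derive_sumf => k; have kn : (n - k <= n)%N by exact: leq_subr.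
apply: (is_derive_eq (is_derive_mul (is_derive_scale (straight_coef k)
  (is_derive_pow k (slope_Delta2 q0))) (inner_Delta2 Y n_gt0 kn))).
have k0 : k.+2%:R != 0 :> R by rewrite pnatr_eq0.
rewrite /A /= -subnS !exprS.
move: (k.+1%:R) (k.+2%:R) k0 (((n - k) * (n - k.+1))%:R) (straight_coef k) => e1 e2 e20 b a.
move: (slope Y) (slope Y ^+ k) (inner _ (n - k) Y) (inner _ (n - k.+1) Y) => u w z1 z2.
by field.
Qed.

End LocalSolution.

Section Normalizer.
Context {R : realType} {n m : nat}.
Local Notation coords := 'M[R]_(n.+1, m).
Implicit Types (Y v : coords) (G : coords -> 'rV[R]_m).
Hypothesis n_ge2 : (2 <= n)%N.
Let n_gt0 : (0 < n)%N := ltnW n_ge2.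

Definition inner_last G Y : R := \sum_i Y (inord 1) i * G Y 0 i.

(** The value of [mu] for which the last component [G + mu n! y_1] of
    [Ghat + mu Delta^n] has inner product [straight] with [y_1]. *)
Definition normalizer G Y : R :=
  (straight Y - inner_last G Y) / (n`!%:R * inner 1 1 Y).

Lemma is_derive_inner_last G Y v : differentiable G Y ->
  is_derive Y v (inner_last G)
    (\sum_i (v (inord 1) i * G Y 0 i + Y (inord 1) i * 'D_v G Y 0 i)).
Proof.
move=> dG; apply: is_derive_sumf => i; apply: is_derive_mul; first exact: is_derive_entry.
apply: DeriveDef; last exact: derive_coord.
by apply: diff_derivable; move: (0 : 'I_1) i; exact/differentiable_mxP.
Qed.

(** Differentiate the relation [n! |y_1|^2 mu + <y_1, G> = straight] that
    defines the normalizer; [l] measures the failure of [Delta^1 G = (n+1) G],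
    which is in the direction of [y_1] only. *)
Lemma normalizer_Delta1 G Y (l : R) : differentiable G Y -> row (inord 1) Y != 0 ->
  (forall i, 'D_(Delta_comp 1 Y) G Y 0 i =
     n.+1%:R * G Y 0 i + l * n`!%:R * Y (inord 1) i) ->
  'D_(Delta_comp 1 Y) (normalizer G) Y = n%:R * normalizer G Y - l.
Proof.
move=> dG Y1 HG; have q0 := inner11_neq0 Y1; have f0 := factR_neq0 (R := R) n.
have nq0 : n`!%:R * inner 1 1 Y != 0 by rewrite mulf_neq0.
have dI : is_derive Y (Delta_comp 1 Y) (inner_last G)
    ((n + 2)%:R * inner_last G Y + l * n`!%:R * inner 1 1 Y).
  apply: (is_derive_eq (is_derive_inner_last _ dG)).
  rewrite /inner_last /inner !mulr_sumr -big_split; apply: eq_bigr => i _ /=.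
  rewrite HG Delta1_entry// addn2 -(natr1 n.+1).
  by move: (n.+1%:R) (Y _ i) (G Y 0 i) (n`!%:R) => a b c d; ring.
have [_ ->] := @is_derive_div _ _ _ (fun Z => n`!%:R * inner 1 1 Z) Y _ _ _ nq0
  (is_derive_add (straight_Delta1 n_ge2 q0) (is_derive_opp dI))
  (is_derive_scale n`!%:R (inner_Delta1 Y n_gt0 n_gt0)).
rewrite /normalizer natrD; move: (straight Y) (inner_last G Y) (inner 1 1 Y) q0 => s u q q0.
move: (n`!%:R) f0 (n%:R) => f f0 a; rewrite -[(1 + 1)%N]/2%N.
by field; rewrite f0 q0.
Qed.

Lemma normalizer_Delta2 G Y (l : R) : differentiable G Y -> row (inord 1) Y != 0 ->
  (forall i, 'D_(Delta_comp 2 Y) G Y 0 i =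
     (n * n.+1)%:R * Y (inord n) i + l * n`!%:R * Y (inord 1) i) ->
  'D_(Delta_comp 2 Y) (normalizer G) Y = - l.
Proof.
move=> dG Y1 HG; have q0 := inner11_neq0 Y1; have f0 := factR_neq0 (R := R) n.
have nq0 : n`!%:R * inner 1 1 Y != 0 by rewrite mulf_neq0.
have dI : is_derive Y (Delta_comp 2 Y) (inner_last G)
    ((n * n.+1)%:R * inner 1 n Y + l * n`!%:R * inner 1 1 Y).
  apply: (is_derive_eq (is_derive_inner_last _ dG)).
  rewrite /inner_last /inner !mulr_sumr -big_split; apply: eq_bigr => i _ /=.
  rewrite HG Delta2_entry// muln0 !mul0r add0r.
  by move: ((n * n.+1)%:R) (Y (inord n) i) (Y (inord 1) i) (n`!%:R) => a b e d; ring.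
have [_ ->] := @is_derive_div _ _ _ (fun Z => n`!%:R * inner 1 1 Z) Y _ _ _ nq0
  (is_derive_add (straight_Delta2 n_ge2 q0) (is_derive_opp dI))
  (is_derive_scale n`!%:R (inner_Delta2 Y n_gt0 n_gt0)).
rewrite /= muln0 !mul0r !mulr0 subr0.
move: ((n * n.+1)%:R * _) (inner 1 1 Y) q0 (n`!%:R) f0 => s q q0 f f0.
by field; rewrite f0 q0.
Qed.

Lemma normalizer_smooth G (U : set coords) : open U ->
  (forall Y, U Y -> row (inord 1) Y != 0) -> smooth_on U G ->
  smooth_on U (normalizer G).
Proof.
move=> oU U1 sG; apply: smooth_termP => //.
have tI r s : smooth_term U (@inner R n m r s).
  by apply: term_sum => i; apply: term_mul; apply: term_smooth; exact: smooth_on_entry.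
have q0 Y : U Y -> inner 1 1 Y != 0 by move=> /U1; exact: inner11_neq0.
have tS : smooth_term U (@slope R n m) by exact: (term_mul (tI _ _) (term_inv (tI _ _) q0)).
have tX k : smooth_term U (fun Y => @slope R n m Y ^+ k).
  elim: k => [|k IH]; first exact: term_cst.
  by apply: term_eq (term_mul tS IH) => Y _; rewrite exprS.
apply: term_mul; last first.
  apply: term_inv; first exact: term_mul (term_cst _ _) (tI _ _).
  by move=> Y UY; rewrite mulf_neq0 ?factR_neq0 ?q0.
apply: term_add.
  by apply: term_sum => k; apply: term_mul (tI _ _); exact: term_mul (term_cst _ _) (tX _).
apply: (@term_eq _ _ _ (fun Y => -1 * inner_last G Y)) => [Y _|]; first by rewrite mulN1r.
apply: term_mul; first exact: term_cst.
apply: term_sum => i; apply: term_mul; apply: term_smooth; first exact: smooth_on_entry.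
exact: smooth_on_coord.
Qed.

End Normalizer.

(** * Brackets of a differential equation field in coordinates *)

Section DifferentialEquationComponents.
Context {R : realType} {n m : nat}.
Local Notation coords := 'M[R]_(n.+1, m).
Implicit Types (Y v : coords) (G : coords -> 'rV[R]_m) (z : 'I_m -> R).
Context (n_gt0 : (0 < n)%N).

Definition de_comp G Y : coords :=
  \matrix_(r, i) if (r < n)%N then Y (inord r.+1) i else G Y 0 i.

Definition vertical z : coords := \matrix_(r, i) if (r < n)%N then 0 else z i.

Lemma de_comp_diff G Y : differentiable G Y -> differentiable (de_comp G) Y.
Proof.
move=> dG; apply/differentiable_mxP => r i.
under eq_fun do rewrite mxE.
case: (r < n)%N; first exact: differentiable_coord.
by move/differentiable_mxP : dG => dG; exact: dG.
Qed.

Lemma derive_de_comp G Y v : differentiable G Y ->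
  'D_v (de_comp G) Y = total v + vertical (fun i => 'D_v G Y 0 i).
Proof.
move=> dG; apply/matrixP => r i; rewrite -(derive_coord _ _ _ (de_comp_diff dG)).
rewrite mxE [X in X + _]mxE [X in _ + X]mxE.
case: ifP => rn.
  rewrite addr0 (@eq_derive_dir _ _ _ _ (fun Z : coords => Z (inord r.+1) i) _ Y _ v).
    exact: derive_entry.
  by move=> h; rewrite mxE rn.
rewrite add0r -(derive_coord _ _ _ dG); apply: eq_derive_dir => h.
by rewrite mxE rn.
Qed.

Lemma de_comp_smooth G U : open U -> smooth_on U G -> smooth_on U (de_comp G).
Proof.
move=> oU sG; apply: smooth_on_mx => // r i; case: (boolP (r < n)%N) => rn.
  apply: (@smooth_on_eq _ _ _ _ (fun Z : coords => Z (inord r.+1) i)) => //.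
    by move=> Y _; rewrite mxE rn.
  exact: smooth_on_entry.
apply: (@smooth_on_eq _ _ _ _ (fun Z : coords => G Z 0 i)) => //.
  by move=> Y _; rewrite mxE (negbTE rn).
exact: smooth_on_coord.
Qed.

Lemma Delta_comp_last Y : Delta_comp n Y = vertical (fun i => n`!%:R * Y (inord 1) i).
Proof.
apply/matrixP => s i; rewrite Delta_compE mxE.
have [sn|ns] := ltnP s n; first by [].
have -> : nat_of_ord s = n by apply/eqP; rewrite eqn_leq ns -ltnS ltn_ord.
by rewrite subnn divr1 addKn.
Qed.

Lemma verticalZ a z : a *: vertical z = vertical (fun i => a * z i).
Proof. by apply/matrixP => s i; rewrite !mxE; case: ifP => //; rewrite mulr0. Qed.

Lemma vertical_inj z z' : vertical z = vertical z' -> z =1 z'.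
Proof. by move=> /matrixP H i; have := H ord_max i; rewrite !mxE ltnn. Qed.

Lemma matrix_ext_last (A B : coords) : (forall (s : 'I_n.+1) i, (s < n)%N -> A s i = B s i) ->
  (forall i, A ord_max i = B ord_max i) -> A = B.
Proof.
move=> H H'; apply/matrixP => s i; have [sn|ns] := ltnP s n; first exact: H.
have -> : s = ord_max by apply/val_inj/eqP; rewrite eqn_leq /= ns -ltnS ltn_ord.
exact: H'.
Qed.

Lemma entryD (A B : coords) s i : (A + B) s i = A s i + B s i.
Proof. by rewrite mxE. Qed.

Lemma entryB (A B : coords) s i : (A - B) s i = A s i - B s i.
Proof. by rewrite !mxE. Qed.

Lemma entryZ a (A : coords) s i : (a *: A) s i = a * A s i.
Proof. by rewrite mxE. Qed.

Lemma vertical_lt z (s : 'I_n.+1) i : (s < n)%N -> vertical z s i = 0.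
Proof. by move=> sn; rewrite mxE sn. Qed.

Lemma vertical_max z i : vertical z ord_max i = z i.
Proof. by rewrite mxE ltnn. Qed.

(** Below the top row a differential equation field is the total derivative, and
    the bracket is the universal one of [total_Delta]. *)
Lemma bracket_Delta_upper G Y r (s : 'I_n.+1) i : differentiable G Y -> (s < n)%N ->
  ('D_(Delta_comp r.+1 Y) (de_comp G) Y - Delta_comp r.+1 (de_comp G Y)) s i =
  r.+1%:R * Delta_comp r Y s i.
Proof.
move=> dG sn; have := @total_Delta R n m s r Y sn s i (leqnn _).
rewrite entryZ => <-; rewrite derive_de_comp// !entryB entryD.
rewrite (vertical_lt _ _ sn) addr0; congr (_ - _).
rewrite !Delta_compE; case: ifP => // rs; congr (_ * _).
have tn : (s + 1 - r.+1 < n)%N by rewrite addn1 subSS (leq_ltn_trans (leq_subr _ _)).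
by rewrite mxE totalE inordK ?tn// ltnW.
Qed.

Lemma bracket_Delta_last G Y r i : differentiable G Y ->
  ('D_(Delta_comp r Y) (de_comp G) Y - Delta_comp r (de_comp G Y)) ord_max i =
  'D_(Delta_comp r Y) G Y 0 i - Delta_comp r (de_comp G Y) ord_max i.
Proof.
move=> dG; rewrite derive_de_comp// entryB entryD; congr (_ - _).
by rewrite vertical_max mxE ltnn add0r.
Qed.

Lemma inord_max : inord n = ord_max :> 'I_n.+1.
Proof. by apply/val_inj; rewrite /= inordK. Qed.

Lemma bracket_Delta1 G Y : differentiable G Y ->
  'D_(Delta_comp 1 Y) (de_comp G) Y - Delta_comp 1 (de_comp G Y) =
  de_comp G Y + vertical (fun i => 'D_(Delta_comp 1 Y) G Y 0 i - n.+1%:R * G Y 0 i).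
Proof.
move=> dG; apply: matrix_ext_last => [s i sn|i].
  rewrite bracket_Delta_upper// mul1r Delta_compE subn0 divff ?factR_neq0// mul1r.
  by rewrite subn0 addn1 entryD (vertical_lt _ _ sn) addr0 mxE sn.
rewrite bracket_Delta_last// entryD vertical_max -inord_max Delta1_entry//.
rewrite inord_max mxE ltnn -(natr1 n).
by move: ('D__ G Y 0 i) (G Y 0 i) (n%:R) => a b e; ring.
Qed.

Lemma bracket_Delta2 G Y : (2 <= n)%N -> differentiable G Y ->
  'D_(Delta_comp 2 Y) (de_comp G) Y - Delta_comp 2 (de_comp G Y) =
  2%:R *: Delta_comp 1 Y +
  vertical (fun i => 'D_(Delta_comp 2 Y) G Y 0 i - (n * n.+1)%:R * Y (inord n) i).
Proof.
move=> n2 dG; apply: matrix_ext_last => [s i sn|i].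
  by rewrite bracket_Delta_upper// entryD entryZ (vertical_lt _ _ sn) addr0.
rewrite bracket_Delta_last// entryD entryZ vertical_max.
rewrite -inord_max Delta1_entry// Delta2_entry//.
have n1 : (n.-1 < n)%N by rewrite prednK.
rewrite mxE inordK ?n1 ?prednK// ?ltnS ?leq_pred// !natrM -(natr1 n).
have -> : n.-1%:R = n%:R - 1 :> R by rewrite -(prednK n_gt0) -natr1 addrK.
by move: ('D__ G Y 0 i) (Y _ i) (n%:R) => a b e; ring.
Qed.

(** With the velocity as pivot, the field and [Delta^1], ..., [Delta^n] are in
    echelon form, so the vanishing of the rows below the top one kills all
    coefficients but the last. *)
Lemma vertical_span G Y z (a : R) (b : 'I_n -> R) : row (inord 1) Y != 0 ->
  vertical z = a *: de_comp G Y + \sum_(r < n) b r *: Delta_comp r.+1 Y ->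
  exists l, vertical z = l *: Delta_comp n Y.
Proof.
move=> Y1 E.
have [k Yk] : exists k, Y (inord 1) k != 0.
  apply/existsP; apply: contra_neqT Y1 => /existsPn H.
  by apply/rowP => i; rewrite !mxE; apply/eqP/negPn/H.
have Es (s : 'I_n.+1) i : vertical z s i =
    a * de_comp G Y s i + \sum_(r < n) b r * Delta_comp r.+1 Y s i.
  by rewrite E entryD entryZ summxE; congr (_ + _); apply: eq_bigr => r _; rewrite entryZ.
(* The row of index 0 only involves the coefficient of the field. *)
have a0 : a = 0.
  have := Es ord0 k; rewrite big1 ?addr0 => [|r _]; last by rewrite Delta_compE mulr0.
  by rewrite !mxE n_gt0 => /esym/eqP; rewrite mulf_eq0 (negbTE Yk) orbF => /eqP.
(* Given the previous coefficients, row r + 1 only involves Delta^(r+1). *)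
have b0 t (r : 'I_n) : nat_of_ord r = t -> (t.+1 < n)%N -> b r = 0.
  elim/ltn_ind: t r => t IH r rt tn.
  have tn1 : (t.+1 < n.+1)%N by exact: ltnW.
  have := Es (inord t.+1) k; rewrite a0 mul0r add0r mxE inordK// tn.
  rewrite (bigD1 r)//= big1 ?addr0 => [|r' r'r].
    rewrite Delta_compE inordK// rt leqnn subnn divr1 addn1 subSS subSnn.
    move=> /esym/eqP; rewrite !mulf_eq0 (negbTE Yk) (negbTE (factR_neq0 _)) !orbF.
    by move=> /eqP.
  have [r't|tr'] := ltnP r' t.
    have r'n : (r'.+1 < n)%N by apply: ltn_trans tn; rewrite ltnS.
    by rewrite (IH r' r't r' erefl r'n) mul0r.
  rewrite Delta_compE inordK// ltnS leqNgt ltn_neqAle tr' andbT -rt.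
  by rewrite eq_sym (_ : (r' == r :> nat) = false) ?mulr0//; apply/negbTE.
have n1 : (n.-1 < n)%N by rewrite prednK.
exists (b (Ordinal n1)); rewrite E a0 scale0r add0r (bigD1 (Ordinal n1))//= big1 ?addr0.
  by rewrite prednK.
move=> r rn; rewrite (b0 r r)// ?scale0r//.
rewrite ltn_neqAle ltn_ord andbT; apply: contra rn => /eqP rn.
by apply/eqP/val_inj; rewrite /= -[LHS]/(r.+1.-1) rn.
Qed.

End DifferentialEquationComponents.

(** * From the charts to the manifold *)

Section Globalization.
Context {R : realType} {m n : nat} {M : manifold R m}.
Hypothesis n_ge2 : (2 <= n)%N.
Let n_gt0 : (0 < n)%N := ltnW n_ge2.
Local Notation TnM := (regular_jet M n).
Local Notation coords := 'M[R]_(n.+1, m).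
Implicit Types (c d : chart R m M) (j k : TnM) (O : set M) (f g : TnM -> R).
Local Notation jet_im := (@jet_im R m n M).

Lemma vector_fieldD (X : operator M n) f g j : vector_field X -> smooth_fun f ->
  smooth_fun g -> X (fun k => f k + g k) j = X f j + X g j.
Proof.
move=> [_ HL _] sf sg; have := HL 1 f g sf sg j; rewrite mul1r => <-.
by congr (X _ j); apply/funext => k; rewrite mul1r.
Qed.

Lemma vector_fieldM (X : operator M n) f g j : vector_field X -> smooth_fun f ->
  smooth_fun g -> X (fun k => f k * g k) j = X f j * g j + f j * X g j.
Proof. by move=> [_ _ HM] sf sg; exact: HM. Qed.

Lemma derive_span c f j (a : R) (A : coords) (N : nat) (b : 'I_N -> R)
    (B : 'I_N -> coords) : atlas c -> jet_over c j -> smooth_fun f ->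
  'D_(a *: A + \sum_(r < N) b r *: B r) (in_coords c f) (jet_coord c j) =
  a * 'D_A (in_coords c f) (jet_coord c j) +
  \sum_(r < N) b r * 'D_(B r) (in_coords c f) (jet_coord c j).
Proof.
move=> ac cj sf; have df := smooth_fun_diff n_gt0 ac cj sf.
rewrite deriveE// linearD linearZ linear_sum deriveE//; congr (_ + _).
by apply: eq_bigr => r _; rewrite linearZ deriveE.
Qed.

Lemma derive_line c f j (a : R) (A B : coords) : atlas c -> jet_over c j -> smooth_fun f ->
  'D_(A + a *: B) (in_coords c f) (jet_coord c j) =
  'D_A (in_coords c f) (jet_coord c j) + a * 'D_B (in_coords c f) (jet_coord c j).
Proof.
move=> ac cj sf; have df := smooth_fun_diff n_gt0 ac cj sf.
by rewrite (deriveDdir _ _ df) (deriveZdir _ _ df).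
Qed.

Lemma Delta_bracket_components r s c j f : (0 < r)%N -> (0 < s)%N -> atlas c ->
  jet_over c j -> smooth_fun f ->
  lie_bracket (Delta r) (Delta s) f j =
  'D_(Delta_comp s (Delta_comp r (jet_coord c j)) -
      Delta_comp r (Delta_comp s (jet_coord c j))) (in_coords c f) (jet_coord c j).
Proof.
move=> r0 s0 ac cj sf.
have L t := @Delta_comp_linear R n m t.
have dL t : differentiable (@Delta_comp R m n t) (jet_coord c j) := linear_mx_diff _ (L t).
have H := lie_bracket_components n_gt0 ac (Delta_vector_field n_gt0 r0)
  (Delta_vector_field n_gt0 s0) (Delta_components n_gt0 r0 ac)
  (Delta_components n_gt0 s0 ac) cj sf (dL r) (dL s).
have E : 'D_(Delta_comp r (jet_coord c j)) (Delta_comp s) (jet_coord c j) -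
    'D_(Delta_comp s (jet_coord c j)) (Delta_comp r) (jet_coord c j) =
    Delta_comp s (Delta_comp r (jet_coord c j)) - Delta_comp r (Delta_comp s (jet_coord c j)).
  congr (_ - _); exact: derive_linear_mx.
by rewrite E in H.
Qed.

Lemma Delta_comp1n (Y : coords) :
  Delta_comp n (Delta_comp 1 Y) - Delta_comp 1 (Delta_comp n Y) =
  (1 - n%:R) *: Delta_comp n Y.
Proof.
apply: matrix_ext_last => [s i sn|i]; rewrite entryB entryZ.
  rewrite -[s]inord_val Delta1_entry ?(ltnW sn)// inord_val.
  by rewrite !Delta_comp_last// !vertical_lt// !mulr0 subr0.
rewrite -inord_max Delta1_entry// inord_max !Delta_comp_last//.
rewrite !vertical_max Delta1_entry//.
by move: (Y _ i) (n`!%:R) (n%:R) => a b e; ring.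
Qed.

Lemma Delta_comp2n (Y : coords) :
  Delta_comp n (Delta_comp 2 Y) - Delta_comp 2 (Delta_comp n Y) = 0.
Proof.
have H (s : nat) i : (s <= n)%N -> Delta_comp 2 (Delta_comp n Y) (inord s) i = 0.
  move=> sn; rewrite Delta2_entry//; case: s sn => [|s] sn; first by rewrite mul0n mul0r.
  by rewrite Delta_comp_last// vertical_lt ?mulr0// inordK// ltnW.
have H' i : vertical (fun l => n`!%:R * Delta_comp 2 Y (inord 1) l) ord_max i = 0 :> R.
  by rewrite vertical_max Delta2_entry// muln0 mul0r mulr0.
apply: matrix_ext_last => [s i sn|i]; rewrite entryB [RHS]mxE.
  by rewrite -[s in X in _ - X]inord_val H ?(ltnW sn)// Delta_comp_last// vertical_lt// subr0.
rewrite -[in X in _ - X]inord_max H// (Delta_comp_last (Delta_comp 2 Y)).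
by rewrite H' subr0.
Qed.

Variable Ghat : operator M n.
Hypothesis Ghat_de : de_field Ghat.
Hypothesis Ghat_hom : homogeneous Ghat.

Lemma Ghat_components c : atlas c -> exists2 G : coords -> 'rV[R]_m,
  smooth_on (jet_im c) G & has_components Ghat c (de_comp G).
Proof.
move=> ac; have [_ /(_ c ac)[G]] := Ghat_de; rewrite (jet_coord_im n_gt0 ac) => sG HG.
by exists G.
Qed.

Lemma Ghat_in_Dplus : in_distribution (Dplus Ghat) Ghat.
Proof.
split; first exact: Ghat_de.1.
move=> j; exists 1, (fun=> 0) => f sf.
by rewrite mul1r big1 ?addr0// => r _; rewrite mul0r.
Qed.

Lemma Delta_in_Dplus r : (r < n)%N -> in_distribution (Dplus Ghat) (Delta r.+1).
Proof.
move=> rn; split; first exact: Delta_vector_field.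
move=> j; exists 0, (fun s => (s == Ordinal rn)%:R) => f sf.
rewrite mul0r add0r (bigD1 (Ordinal rn))//= eqxx mul1r big1 ?addr0// => s sr.
by rewrite (negbTE sr) mul0r.
Qed.

(** Involutivity is a statement on derivations of global functions; separation of
    tangent vectors turns it into a linear relation in coordinates. *)
Lemma bracket_in_span r c j (G : coords -> 'rV[R]_m) : (r < n)%N -> atlas c ->
  jet_over c j -> smooth_on (jet_im c) G -> has_components Ghat c (de_comp G) ->
  exists a (b : 'I_n -> R), 'D_(Delta_comp r.+1 (jet_coord c j)) (de_comp G) (jet_coord c j) -
    Delta_comp r.+1 (de_comp G (jet_coord c j)) =
  a *: de_comp G (jet_coord c j) + \sum_(s < n) b s *: Delta_comp s.+1 (jet_coord c j).
Proof.
move=> rn ac cj sG HG.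
have [_ /(_ j)[a [b H]]] := Ghat_hom (Delta_in_Dplus rn) Ghat_in_Dplus.
exists a, b; apply: (tangent_eq n_gt0 ac cj) => f sf.
rewrite derive_span//; set Y := jet_coord c j.
have iY : jet_im c Y by exact: jet_im_coord.
have dV : differentiable (de_comp G) Y by apply: de_comp_diff; exact: smooth_on_diff sG iY.
have L := @Delta_comp_linear R n m r.+1.
have B := lie_bracket_components n_gt0 ac (Delta_vector_field n_gt0 (ltn0Sn r)) Ghat_de.1
  (Delta_components n_gt0 (ltn0Sn r) ac) HG cj sf (linear_mx_diff _ L) dV.
rewrite (derive_linear_mx Y (de_comp G Y) L) in B; rewrite -B H//; congr (_ + _).
  by congr (_ * _); exact: HG.
by apply: eq_bigr => s _; rewrite (Delta_components n_gt0 (ltn0Sn s) ac sf cj).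
Qed.

(** The bracket differs from the expected field by a vertical vector, and it lies
    in [Dplus Ghat] by involutivity; so the difference is a multiple of
    [Delta^n]. *)
Lemma defect1_exists : exists l : TnM -> R, forall j f, smooth_fun f ->
  lie_bracket (Delta 1) Ghat f j = Ghat f j + l j * Delta n f j.
Proof.
suff H j : exists a : R, forall f, smooth_fun f ->
    lie_bracket (Delta 1) Ghat f j = Ghat f j + a * Delta n f j.
  by have [l Hl] := choice H; exists l.
have [ac cj] := chart_atP j; set c := chart_at j in ac cj.
have [G sG HG] := Ghat_components ac.
set Y := jet_coord c j; have iY : jet_im c Y by exact: jet_im_coord.
have dG : differentiable G Y := smooth_on_diff sG iY.
have [a [b]] := bracket_in_span n_gt0 ac cj sG HG; rewrite -/Y bracket_Delta1// => E.
set z := fun i : 'I_m => _ in E.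
have [l Hl] : exists l, vertical z = l *: Delta_comp n Y.
  apply: (@vertical_span _ _ _ n_gt0 G Y z (a - 1) b iY.2).
  by rewrite scalerBl scale1r addrAC -E addrC addKr.
exists l => f sf.
rewrite (lie_bracket_components n_gt0 ac (Delta_vector_field n_gt0 (ltn0Sn 0)) Ghat_de.1
  (Delta_components n_gt0 (ltn0Sn 0) ac) HG cj sf
  (linear_mx_diff _ (@Delta_comp_linear R n m 1)) (de_comp_diff dG)).
rewrite -/Y (derive_linear_mx Y _ (@Delta_comp_linear R n m 1)).
rewrite bracket_Delta1// -/z Hl derive_line// (HG f sf j cj).
by rewrite (Delta_components n_gt0 n_gt0 ac sf cj).
Qed.

Lemma defect2_exists : exists l : TnM -> R, forall j f, smooth_fun f ->
  lie_bracket (Delta 2) Ghat f j = 2 * Delta 1 f j + l j * Delta n f j.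
Proof.
suff H j : exists a : R, forall f, smooth_fun f ->
    lie_bracket (Delta 2) Ghat f j = 2 * Delta 1 f j + a * Delta n f j.
  by have [l Hl] := choice H; exists l.
have [ac cj] := chart_atP j; set c := chart_at j in ac cj.
have [G sG HG] := Ghat_components ac.
set Y := jet_coord c j; have iY : jet_im c Y by exact: jet_im_coord.
have dG : differentiable G Y := smooth_on_diff sG iY.
have [a [b]] := bracket_in_span n_ge2 ac cj sG HG; rewrite -/Y bracket_Delta2// => E.
set z := fun i : 'I_m => _ in E.
have [l Hl] : exists l, vertical z = l *: Delta_comp n Y.
  apply: (@vertical_span _ _ _ n_gt0 G Y z a
    (fun s => b s - 2 * (s == Ordinal n_gt0)%:R) iY.2).
  under eq_bigr do rewrite scalerBl.
  rewrite sumrB addrA -E [X in _ = _ - X](bigD1 (Ordinal n_gt0))// eqxx mulr1.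
  rewrite [X in _ - (_ + X)]big1 ?addr0 => [|s sr]; first by rewrite addrC addKr.
  by rewrite (negbTE sr) mulr0 scale0r.
exists l => f sf.
rewrite (lie_bracket_components n_gt0 ac (Delta_vector_field n_gt0 (ltn0Sn 1)) Ghat_de.1
  (Delta_components n_gt0 (ltn0Sn 1) ac) HG cj sf
  (linear_mx_diff _ (@Delta_comp_linear R n m 2)) (de_comp_diff dG)).
rewrite -/Y (derive_linear_mx Y _ (@Delta_comp_linear R n m 2)).
rewrite bracket_Delta2// -/z Hl derive_line//.
rewrite (deriveZdir _ _ (smooth_fun_diff n_gt0 ac cj sf)).
rewrite (Delta_components n_gt0 n_gt0 ac sf cj).
by rewrite (Delta_components n_gt0 (ltn0Sn 0) ac sf cj).
Qed.

Section Partial.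
Variables (l1 l2 : TnM -> R).
Hypothesis Hl1 : forall j f, smooth_fun f ->
  lie_bracket (Delta 1) Ghat f j = Ghat f j + l1 j * Delta n f j.
Hypothesis Hl2 : forall j f, smooth_fun f ->
  lie_bracket (Delta 2) Ghat f j = 2 * Delta 1 f j + l2 j * Delta n f j.

Lemma defect1_components c j (G : coords -> 'rV[R]_m) i : atlas c -> jet_over c j ->
  smooth_on (jet_im c) G -> has_components Ghat c (de_comp G) ->
  'D_(Delta_comp 1 (jet_coord c j)) G (jet_coord c j) 0 i =
  n.+1%:R * G (jet_coord c j) 0 i + l1 j * n`!%:R * jet_coord c j (inord 1) i.
Proof.
move=> ac cj sG HG; set Y := jet_coord c j.
have dG : differentiable G Y by apply: smooth_on_diff sG _; exact: jet_im_coord.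
have : de_comp G Y + vertical (fun i => 'D_(Delta_comp 1 Y) G Y 0 i - n.+1%:R * G Y 0 i)
    = de_comp G Y + l1 j *: Delta_comp n Y.
  rewrite -bracket_Delta1//; apply: (tangent_eq n_gt0 ac cj) => f sf.
  rewrite derive_line// -(HG f sf j cj) -(Delta_components n_gt0 n_gt0 ac sf cj) -Hl1//.
  rewrite (lie_bracket_components n_gt0 ac (Delta_vector_field n_gt0 (ltn0Sn 0)) Ghat_de.1
    (Delta_components n_gt0 (ltn0Sn 0) ac) HG cj sf
    (linear_mx_diff _ (@Delta_comp_linear R n m 1)) (de_comp_diff dG)).
  by rewrite -/Y (derive_linear_mx Y _ (@Delta_comp_linear R n m 1)).
move=> /addrI; rewrite Delta_comp_last verticalZ => /vertical_inj/(_ i) /eqP.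
by rewrite subr_eq addrC mulrA => /eqP.
Qed.

Lemma defect2_components c j (G : coords -> 'rV[R]_m) i : atlas c -> jet_over c j ->
  smooth_on (jet_im c) G -> has_components Ghat c (de_comp G) ->
  'D_(Delta_comp 2 (jet_coord c j)) G (jet_coord c j) 0 i =
  (n * n.+1)%:R * jet_coord c j (inord n) i + l2 j * n`!%:R * jet_coord c j (inord 1) i.
Proof.
move=> ac cj sG HG; set Y := jet_coord c j.
have dG : differentiable G Y by apply: smooth_on_diff sG _; exact: jet_im_coord.
have : 2 *: Delta_comp 1 Y +
     vertical (fun i => 'D_(Delta_comp 2 Y) G Y 0 i - (n * n.+1)%:R * Y (inord n) i)
    = 2 *: Delta_comp 1 Y + l2 j *: Delta_comp n Y.
  rewrite -bracket_Delta2//; apply: (tangent_eq n_gt0 ac cj) => f sf.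
  rewrite derive_line// (deriveZdir _ _ (smooth_fun_diff n_gt0 ac cj sf)).
  rewrite -(Delta_components n_gt0 (ltn0Sn 0) ac sf cj).
  rewrite -(Delta_components n_gt0 n_gt0 ac sf cj).
  rewrite -[_ *: Delta 1 f j]/(_ * _) -Hl2//.
  rewrite (lie_bracket_components n_gt0 ac (Delta_vector_field n_gt0 (ltn0Sn 1)) Ghat_de.1
    (Delta_components n_gt0 (ltn0Sn 1) ac) HG cj sf
    (linear_mx_diff _ (@Delta_comp_linear R n m 2)) (de_comp_diff dG)).
  by rewrite -/Y (derive_linear_mx Y _ (@Delta_comp_linear R n m 2)).
move=> /addrI; rewrite Delta_comp_last verticalZ => /vertical_inj/(_ i) /eqP.
by rewrite subr_eq addrC mulrA => /eqP.
Qed.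

(** For [w = 1] these are the equations that make [mu] correct the defects [l1]
    and [l2]. They are affine in [mu], and a weight [w] that is invariant
    allows solutions given on parts of the manifold to be added. *)
Definition partial_solution (mu w : TnM -> R) : Prop :=
  [/\ smooth_fun mu, smooth_fun w &
   forall j, [/\ Delta 1 mu j = n%:R * mu j - w j * l1 j, Delta 2 mu j = - (w j * l2 j),
                 Delta 1 w j = 0 & Delta 2 w j = 0]].

Lemma chart_partial_solution c b : atlas c -> cutoff c b ->
  exists mu, partial_solution mu (cut c b (cst 1)).
Proof.
move=> ac cb; have [G sG HG] := Ghat_components ac.
have sN : smooth_on (jet_im c) (normalizer G).
  by apply: normalizer_smooth => //; [exact: jet_im_open|move=> Y []].
have s1 : smooth_on (jet_im c) (cst (1 : R)) by exact: smooth_on_cst.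
exists (cut c b (normalizer G)); split; [exact: cut_smooth|exact: cut_smooth|move=> j].
have [cj|cj] := pselect (jet_over c j); last first.
  have [D1 b0] := Delta_cut_off n_gt0 1 (normalizer G) cb cj.
  have [D2 _] := Delta_cut_off n_gt0 2 (normalizer G) cb cj.
  have [D3 _] := Delta_cut_off n_gt0 1 (cst 1) cb cj.
  have [D4 _] := Delta_cut_off n_gt0 2 (cst 1) cb cj.
  rewrite D1 D2 D3 D4 /cut asboolF//; split=> //; first by rewrite mulr0 mul0r subr0.
  by rewrite mul0r oppr0.
have iY : jet_im c (jet_coord c j) by exact: jet_im_coord.
have dG : differentiable G (jet_coord c j) := smooth_on_diff sG iY.
rewrite !(Delta_cut n_gt0 _ ac cb _ cj)// !derive_cst mulr0 !cut_over// mulr1.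
rewrite (normalizer_Delta1 n_ge2 (l := l1 j) dG iY.2); last first.
  by move=> i; exact: defect1_components.
rewrite (normalizer_Delta2 n_ge2 (l := l2 j) dG iY.2); last first.
  by move=> i; exact: defect2_components.
by split=> //; [rewrite mulrBr mulrCA|rewrite mulrN].
Qed.

Lemma local_partial_solution (p : M) : exists W : set M, [/\ open W, W p &
  exists mu w, partial_solution mu w /\ forall j, W (jet_rep j 0) -> w j = 1].
Proof.
have [c ac cp] := atlas_cover p; have [b [W [cb oW Wp b1]]] := exists_cutoff cp.
have [mu Hmu] := chart_partial_solution ac cb.
exists W; split=> //; exists mu, (cut c b (cst 1)); split=> // j Wj.
have [cj|cj] := pselect (jet_over c j); first by rewrite cut_over// b1// mulr1.
have [_] := Delta_cut_off n_gt0 1 (cst 1) cb cj.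
by rewrite b1// => /eqP; rewrite oner_eq0.
Qed.

Lemma partial_solution0 : partial_solution (fun=> 0) (fun=> 0).
Proof.
split; [exact: smooth_fun_cst|exact: smooth_fun_cst|].
by move=> j; rewrite !Delta_cst// mulr0 !mul0r subr0 oppr0.
Qed.

(** The weights combine as [1 - w'' = (1 - w)(1 - w')]. Where [w] is already [1]
    the join changes neither the solution nor the weight. *)
Lemma partial_solution_join mu w mu' w' :
  partial_solution mu w -> partial_solution mu' w' ->
  partial_solution (fun j => mu j + (1 - w j) * mu' j) (fun j => w j + (1 - w j) * w' j).
Proof.
move=> [smu sw H] [smu' sw' H'].
have -> : (fun j => mu j + (1 - w j) * mu' j) = fun j => mu j + (1 + -1 * w j) * mu' j.
  by apply/funext => j; rewrite mulN1r.
have -> : (fun j => w j + (1 - w j) * w' j) = fun j => w j + (1 + -1 * w j) * w' j.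
  by apply/funext => j; rewrite mulN1r.
have sc (a : R) : smooth_fun (fun _ : TnM => a) by exact: smooth_fun_cst.
have sNw := smooth_funM n_gt0 (sc (-1)) sw.
have su := smooth_funD n_gt0 (sc 1) sNw.
have su1 := smooth_funM n_gt0 su smu'; have su2 := smooth_funM n_gt0 su sw'.
split; [exact: smooth_funD|exact: smooth_funD|].
have DE r g g' j : (0 < r)%N -> smooth_fun g -> smooth_fun g' -> Delta r w j = 0 ->
    Delta r (fun k => g k + (1 + -1 * w k) * g' k) j =
    Delta r g j + (1 + -1 * w j) * Delta r g' j.
  move=> r0 sg sg' Dw; have VF := @Delta_vector_field R m n M n_gt0 r r0.
  rewrite (vector_fieldD j VF sg (smooth_funM n_gt0 su sg')).
  rewrite (vector_fieldM j VF su sg') (vector_fieldD j VF (sc 1) sNw).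
  by rewrite (vector_fieldM j VF (sc (-1)) sw) !Delta_cst// Dw mulr0 mul0r !addr0 mul0r add0r.
move=> j; have [H1 H2 H3 H4] := H j; have [H'1 H'2 H'3 H'4] := H' j.
rewrite !DE// H1 H2 H3 H4 H'1 H'2 H'3 H'4; split; last 2 first.
- by rewrite mulr0 addr0.
- by rewrite mulr0 addr0.
- by move: (mu j) (w j) (mu' j) (w' j) (l1 j) => a b a' b' l; ring.
- by move: (w j) (w' j) (l2 j) => b b' l; ring.
Qed.

(** The partial solutions are indexed by a countable base of the topology: to a
    basic open set on which some partial solution has weight [1] is attached
    such a solution, and zero to all other indices. *)
Lemma partial_sequence : exists mu w : nat -> TnM -> R,
  (forall k : nat, partial_solution (mu k) (w k)) /\
  forall p : M, exists (k : nat) (W : set M), [/\ open W, W p & forall j, W (jet_rep j 0) -> w k j = 1].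
Proof.
have [B /countable_injP[code inj] [Bo Bx]] := manifold_second_countable M.
pose good (A : set M) (mu w : TnM -> R) :=
  partial_solution mu w /\ forall j, A (jet_rep j 0) -> w j = 1.
have H (k : nat) : exists pr : (TnM -> R) * (TnM -> R), partial_solution pr.1 pr.2 /\
    forall A, B A -> code A = k -> (exists mu w, good A mu w) ->
    forall j, A (jet_rep j 0) -> pr.2 j = 1.
  have [[A [BA Ak [mu [w [pmw gA]]]]]|no] :=
    pselect (exists A, [/\ B A, code A = k & exists mu w, good A mu w]).
    exists (mu, w); split=> // A' BA' A'k _.
    suff -> : A' = A by [].
    by apply: inj; rewrite ?inE// A'k.
  exists ((fun=> 0), (fun=> 0)); split; first exact: partial_solution0.
  by move=> A BA Ak gA; case: no; exists A.
have [pr Hpr] := choice H.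
exists (fun k : nat => (pr k).1), (fun k : nat => (pr k).2); split=> [k|p]; first exact: (Hpr k).1.
have [W [oW Wp [mu [w [pmw w1]]]]] := local_partial_solution p.
have [A [BA Ap] AW] := Bx p W (open_nbhs_nbhs (conj oW Wp)).
exists (code A), A; split=> //; first exact: Bo.
apply: ((Hpr (code A)).2 A BA erefl).
by exists mu, w; split=> // j Aj; apply: w1; exact: AW.
Qed.

(** Near each base point the successive joins have weight [1] after finitely many
    steps and are constant from then on, so that their limit is smooth and
    solves the equations with weight [1]. *)
Lemma global_solution : exists2 mu : TnM -> R, smooth_fun mu &
  forall j, Delta 1 mu j = n%:R * mu j - l1 j /\ Delta 2 mu j = - l2 j.
Proof.
have [mu [w [pmw cov]]] := partial_sequence.
pose S := fix S (k : nat) : (TnM -> R) * (TnM -> R) := if k is k'.+1 then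
  ((fun j => (S k').1 j + (1 - (S k').2 j) * mu k' j),
   (fun j => (S k').2 j + (1 - (S k').2 j) * w k' j)) else ((fun=> 0), (fun=> 0)).
have pS (k : nat) : partial_solution (S k).1 (S k).2.
  by elim: k => [|k IH]; [exact: partial_solution0|exact: partial_solution_join].
have stab (k K : nat) j : (S k).2 j = 1 -> (S (k + K)%N).2 j = 1 /\ (S (k + K)%N).1 j = (S k).1 j.
  move=> Sk; elim: K => [|K [IH2 IH1]]; first by rewrite addn0.
  by rewrite addnS /= IH2 IH1 subrr !mul0r !addr0.
have agree (k k' : nat) j : (S k).2 j = 1 -> (S k').2 j = 1 -> (S k).1 j = (S k').1 j.
  move=> Sk Sk'; have [_ <-] := stab k k' j Sk; have [_ <-] := stab k' k j Sk'.
  by rewrite addnC.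
have covS (p : M) : exists (k : nat) (W : set M), [/\ open W, W p & forall j, W (jet_rep j 0) -> (S k).2 j = 1].
  have [k [W [oW Wp w1]]] := cov p; exists k.+1, W; split=> // j Wj.
  by rewrite /= w1// mulr1 addrC subrK.
have HS j : exists k : nat, (S k).2 j = 1.
  have [k [W [_ Wj H]]] := covS (jet_rep j 0).
  by exists k; exact: H.
have [N HN] := choice HS.
pose sol j := (S (N j)).1 j.
have loc j : exists (k : nat) (W : set M), [/\ open W, W (jet_rep j 0), forall j', W (jet_rep j' 0) ->
    sol j' = (S k).1 j' & (S k).2 j = 1].
  have [k [W [oW Wj H]]] := covS (jet_rep j 0); exists k, W; split=> //; last exact: H.
  by move=> j' Wj'; apply: agree => //; exact: H.
exists sol.
  apply: (smooth_fun_eq_local n_gt0) => j; have [k [W [oW Wj E _]]] := loc j.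
  by exists W, (S k).1; split=> //; have [] := pS k.
move=> j; have [k [W [oW Wj E Sk]]] := loc j; have [_ _ /(_ j)[H1 H2 _ _]] := pS k.
rewrite !(Delta_near n_gt0 _ oW Wj E) H1 H2 Sk !mul1r; split=> //.
by rewrite E.
Qed.

End Partial.

Lemma de_field_shift (mu : TnM -> R) : smooth_fun mu ->
  de_field (fun f j => Ghat f j + mu j * Delta n f j).
Proof.
move=> smu; set X : operator M n := fun f j => _.
have comp c : atlas c -> exists2 G : coords -> 'rV[R]_m,
    smooth_on (jet_im c) G & has_components X c (de_comp G).
  move=> ac; have [G sG HG] := Ghat_components ac.
  have sm := (smooth_funE n_gt0 mu).1 smu c ac; have oI := @jet_im_open R m n M c.
  exists (fun Y => \row_i (G Y 0 i + in_coords c mu Y * (n`!%:R * Y (inord 1) i))).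
    apply: smooth_on_mx => // i0 i; apply: smooth_termP => //.
    apply: (@term_eq _ _ _ (fun Y => G Y 0 i + in_coords c mu Y * (n`!%:R * Y (inord 1) i))).
      by move=> Y _; rewrite mxE.
    apply: term_add; first by apply: term_smooth; exact: smooth_on_coord.
    apply: term_mul; first exact: term_smooth.
    by apply: term_mul; [exact: term_cst|apply: term_smooth; exact: smooth_on_entry].
  move=> f sf j cj; rewrite /X (HG f sf j cj) (Delta_components n_gt0 n_gt0 ac sf cj).
  rewrite -(derive_line _ _ _ ac cj sf); set A := _ + _; set B := de_comp _ _.
  suff -> : A = B by [].
  apply: matrix_ext_last => [s i sn|i]; rewrite /A /B entryD entryZ Delta_comp_last.
    by rewrite vertical_lt// mulr0 addr0 !mxE sn.
  by rewrite vertical_max !mxE ltnn in_coordsE.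
split.
  apply: (components_vector_field n_gt0) => c /comp[G sG HG]; exists (de_comp G) => //.
  by apply: de_comp_smooth => //; exact: jet_im_open.
by move=> c ac; rewrite (jet_coord_im n_gt0 ac); exact: comp.
Qed.

Lemma bracket_shift r (mu f : TnM -> R) j : (0 < r)%N -> smooth_fun mu -> smooth_fun f ->
  lie_bracket (Delta r) (fun f j => Ghat f j + mu j * Delta n f j) f j =
  lie_bracket (Delta r) Ghat f j + Delta r mu j * Delta n f j +
  mu j * lie_bracket (Delta r) (Delta n) f j.
Proof.
move=> r0 smu sf; rewrite /lie_bracket.
have [sD _ _] := @Delta_vector_field R m n M n_gt0 n n_gt0.
have [sG _ _] := Ghat_de.1; have VF := @Delta_vector_field R m n M n_gt0 r r0.
have sm := smooth_funM n_gt0 smu (sD f sf).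
rewrite (vector_fieldD j VF (sG f sf) sm) (vector_fieldM j VF smu (sD f sf)).
move: (Delta r (Ghat f) j) (Ghat (Delta r f) j) (Delta r mu j) (mu j) => a b e d.
move: (Delta n f j) (Delta r (Delta n f) j) (Delta n (Delta r f) j) => u w z.
by ring.
Qed.

Lemma bracket_Delta1n f j : smooth_fun f ->
  lie_bracket (@Delta R m M n 1) (Delta n) f j = (1 - n%:R) * Delta n f j.
Proof.
move=> sf; have [ac cj] := chart_atP j.
rewrite (Delta_bracket_components (ltn0Sn 0) n_gt0 ac cj sf) Delta_comp1n.
rewrite (deriveZdir _ _ (smooth_fun_diff n_gt0 ac cj sf)).
by rewrite (Delta_components n_gt0 n_gt0 ac sf cj).
Qed.

Lemma bracket_Delta2n f j : smooth_fun f ->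
  lie_bracket (@Delta R m M n 2) (Delta n) f j = 0.
Proof.
move=> sf; have [ac cj] := chart_atP j.
by rewrite (Delta_bracket_components (ltn0Sn 1) n_gt0 ac cj sf) Delta_comp2n derive0.
Qed.

End Globalization.

Theorem theorem1 (R : realType) (m n : nat) (M : manifold R m)
    (n_ge2 : (2 <= n)%N) (Ghat : operator M n)
    (Ghat_de : de_field Ghat) (Ghat_hom : homogeneous Ghat) :
  exists2 mu : regular_jet M n -> R, smooth_fun mu &
    let Gam : operator M n := fun f j => Ghat f j + mu j * Delta n f j in
    [/\ de_field Gam,
        in_distribution (Dplus Ghat) Gam,
        same_field (lie_bracket (Delta 1) Gam) Gam &
        same_field (lie_bracket (Delta 2) Gam)
                   (fun f j => 2%:R * Delta 1 f j)].
Proof.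
have n_gt0 : (0 < n)%N := ltnW n_ge2.
have [l1 Hl1] := defect1_exists n_ge2 Ghat_de Ghat_hom.
have [l2 Hl2] := defect2_exists n_ge2 Ghat_de Ghat_hom.
have [mu smu Hmu] := global_solution n_ge2 Ghat_de Hl1 Hl2.
have deG := de_field_shift n_ge2 Ghat_de smu.
exists mu => //=; split=> //.
- split; first exact: deG.1.
  have n1 : (n.-1 < n)%N by rewrite prednK.
  move=> j; exists 1, (fun s => mu j * (s == Ordinal n1)%:R) => f sf.
  rewrite mul1r; congr (_ + _).
  rewrite (bigD1 (Ordinal n1))//= eqxx mulr1 prednK// big1 ?addr0// => s sr.
  by rewrite (negbTE sr) mulr0 mul0r.
- move=> f sf j; have [H1 _] := Hmu j.
  rewrite (bracket_shift n_ge2 Ghat_de j (ltn0Sn 0) smu sf) Hl1// H1 bracket_Delta1n//.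
  by move: (Ghat f j) (Delta n f j) (mu j) (l1 j) => a b e l; ring.
- move=> f sf j; have [_ H2] := Hmu j.
  rewrite (bracket_shift n_ge2 Ghat_de j (ltn0Sn 1) smu sf) Hl2// H2 bracket_Delta2n//.
  by rewrite mulr0 addr0 mulNr addrK.
Qed.
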